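(* Let $N\ge1$ and consider the differential calculus of the fuzzy sphere spectral triple $(A_N,H_N,D_N)$ described in the context, with $\mathcal{E}=\Omega^1(A_N)$. Then: (1) the multiplication map $\mathcal{Z}(\mathcal{E})\otimes_{\mathcal{Z}(A_N)}A_N\to\mathcal{E}$ is an isomorphism; (2) there is a right $A_N$-submodule $\mathcal{F}\subseteq\mathcal{E}\otimes_{A_N}\mathcal{E}$ with $\mathcal{E}\otimes_{A_N}\mathcal{E}=\ker(\wedge)\oplus\mathcal{F}$ and $\wedge|_{\mathcal{F}}:\mathcal{F}\to\Omega^2(A_N)$ a right $A_N$-module isomorphism; (3) for the associated $\sigma=2P_{\rm sym}-1$, $\sigma(\omega\otimes_{A_N}\eta)=\eta\otimes_{A_N}\omega$ for all $\omega,\eta\in\mathcal{Z}(\mathcal{E})$. Consequently, for every pseudo-Riemannian bilinear metric $g$ on $\mathcal{E}$ there exists a unique connection on $\mathcal{E}$ which is torsionless and compatible with $g$ on $\mathcal{Z}(\mathcal{E})$.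
   Context: Fuzzy sphere spectral triple: $J_1,J_2,J_3$ basis of $su(2)$ with $[J_k,J_l]=\sum_m\epsilon_{klm}J_m$; $\rho_{n/2}$ the $(n+1)$-dimensional irreducible unitary representation; $K_N=\oplus_{n=0}^N\mathbb{C}^{n+1}$, $X_k=\oplus_{n=0}^N\rho_{n/2}(J_k)$, $A_N=B(K_N)$, $H_N=K_N\otimes\mathbb{C}^2$ with $a\mapsto a\otimes1$, $\sigma_k=\sqrt{-1}\tau_k$ ($\tau_k$ Pauli matrices), $D_N=\sum_kX_k\otimes\sigma_k$, $B(H_N)=A_N\otimes M_2(\mathbb{C})$. Its differential calculus: $\Omega^1(A_N)=\{\sum a_j[D_N,b_j]\}$, $da=[D_N,a]$; $\Omega^2(A_N)=\mathcal{S}/J^2$ where $\mathcal{S}$ is the span of products $a_0[D_N,a_1][D_N,a_2]$ and $J^2=\{\sum_j[D_N,a_j][D_N,b_j]:\sum_ja_j[D_N,b_j]=0\}$; $\wedge:\mathcal{E}\otimes_{A_N}\mathcal{E}\to\Omega^2(A_N)$ is operator multiplication followed by the quotient map, and $d$ on one-forms is $d(\sum a_j[D_N,b_j])=[\sum_j[D_N,a_j][D_N,b_j]]$. $\mathcal{Z}(\mathcal{M})=\{m:am=ma\ \forall a\}$. $P_{\rm sym}$ is the idempotent with image $\ker\wedge$ and kernel $\mathcal{F}$. A connection is a $\mathbb{C}$-linear $\nabla:\mathcal{E}\to\mathcal{E}\otimes_{A_N}\mathcal{E}$ with $\nabla(\omega a)=\nabla(\omega)a+\omega\otimes da$; torsionless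 means $\wedge\circ\nabla+d=0$. A pseudo-Riemannian bilinear metric is an $A_N$-bimodule map $g:\mathcal{E}\otimes_{A_N}\mathcal{E}\to A_N$ with $g\circ\sigma=g$ and $e\mapsto g(e\otimes-)$ a right module isomorphism $\mathcal{E}\to\mathrm{Hom}_{A_N}(\mathcal{E},A_N)$. Compatibility on $\mathcal{Z}(\mathcal{E})$: $(g\otimes\mathrm{id})\{\sigma_{23}(\nabla(\omega)\otimes\eta)+\omega\otimes\nabla(\eta)\}=d(g(\omega\otimes\eta))$ for all $\omega,\eta\in\mathcal{Z}(\mathcal{E})$, with $\sigma_{23}=\mathrm{id}\otimes\sigma$ and $(g\otimes\mathrm{id})(x\otimes y\otimes z)=g(x\otimes y)z$. *)

(* Defs.v *)
From HB Require Import structures.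
From mathcomp Require Import all_boot all_algebra.
From mathcomp Require Import complex mxtens.
From mathcomp Require Import Rstruct.

Set Implicit Arguments.
Unset Strict Implicit.
Unset Printing Implicit Defensive.

Import GRing.Theory Num.Theory.
Local Open Scope ring_scope.

Notation C := (complex Rdefinitions.R).
Definition iC : C := Complex 0 1.

Definition adjmx {n} (A : 'M[C]_n) : 'M[C]_n := (map_mx Num.conj A)^T.
Definition commx {n} (A B : 'M[C]_n) : 'M[C]_n := A *m B - B *m A.

Definition k1 : 'I_3 := @Ordinal 3 0 isT.
Definition k2 : 'I_3 := @Ordinal 3 1 isT.
Definition k3 : 'I_3 := @Ordinal 3 2 isT.

(* rho = (rho(J_1), rho(J_2), rho(J_3)) is an irreducible unitary representation of
   su(2) on C^n, where [J_k,J_l] = sum_m eps_klm J_m, i.e. [J1,J2]=J3, [J2,J3]=J1,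
   [J3,J1]=J2 (the remaining relations follow by antisymmetry).  Unitary: the
   rho(J_k) are skew-Hermitian.  Irreducible: no invariant subspaces except 0 and
   C^n (subspaces are row spaces of matrices U, with vectors as rows, so that
   invariance of the column-vector action v |-> rho v reads U rho^T <= U). *)
Definition su2_irrep (n : nat) (rho : 'I_3 -> 'M[C]_n) : Prop :=
  [/\ forall k, adjmx (rho k) = - rho k,
      commx (rho k1) (rho k2) = rho k3,
      commx (rho k2) (rho k3) = rho k1,
      commx (rho k3) (rho k1) = rho k2 &
      forall U : 'M[C]_n,
        (forall k, (U *m (rho k)^T <= U)%MS) -> \rank U = 0%N \/ \rank U = n].

Definition tau (k : 'I_3) : 'M[C]_2 :=
  \matrix_(a < 2, b < 2)
    if (k : nat) == 0%N then (if (a : nat) == b then 0 else 1)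
    else if (k : nat) == 1%N then
      (if (a : nat) == b then 0 else if (a : nat) == 0%N then - iC else iC)
    else (if (a : nat) == b then (if (a : nat) == 0%N then 1 else -1) else 0).
Definition sig (k : 'I_3) : 'M[C]_2 := iC *: tau k.

Section FuzzySphere.
Variable N : nat.
(* rho n = rho_{n/2}, the (n+1)-dimensional irreducible representation *)
Variable rho : forall n : 'I_N.+1, 'I_3 -> 'M[C]_n.+1.

(* K_N = (+)_{n=0}^N C^{n+1} *)
Definition Kdim : nat := \sum_(n < N.+1) n.+1.
(* H_N = K_N (x) C^2 *)
Definition Hdim : nat := (Kdim * 2)%N.

Notation AN := 'M[C]_Kdim.
Notation BH := 'M[C]_Hdim.

Definition Xop (k : 'I_3) : AN := \mxdiag_(n < N.+1) rho n k.
Definition piA (a : AN) : BH := a *t (1%:M : 'M[C]_2).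
Definition DN : BH := \sum_(k < 3) Xop k *t sig k.
Definition dD (x : BH) : BH := DN *m x - x *m DN.

Definition inOmega1 (w : BH) : Prop :=
  exists s : seq (AN * AN), w = \sum_(q <- s) piA q.1 *m dD (piA q.2).
Definition inSprod (w : BH) : Prop :=
  exists s : seq (AN * AN * AN),
    w = \sum_(q <- s) piA q.1.1 *m dD (piA q.1.2) *m dD (piA q.2).
(* J^2 = { sum_j [D,a_j][D,b_j] : sum_j a_j [D,b_j] = 0 } ;
   Omega^2(A_N) = S / J^2, so x = y in Omega^2 iff inJ2 (x - y) *)
Definition inJ2 (w : BH) : Prop :=
  exists s : seq (AN * AN),
    \sum_(q <- s) piA q.1 *m dD (piA q.2) = 0 /\
    w = \sum_(q <- s) dD (piA q.1) *m dD (piA q.2).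

Definition inZA (z : AN) : Prop := forall b : AN, z *m b = b *m z.
Definition inZE (w : BH) : Prop := inOmega1 w /\ forall a : AN, piA a *m w = w *m piA a.

(* ---------- E (x)_{A_N} E ----------
   Elements are represented by formal sums  s = [:: (w_1,e_1); ...]  (meaning
   sum_j w_j (x) e_j) with all w_j, e_j in E.  E (x)_C E is realised inside
   M_Hdim (x)_C M_Hdim = M_(Hdim*Hdim) through the Kronecker product *t (an
   isomorphism of the algebraic tensor product), and E (x)_{A_N} E is its quotient
   by the span of the balancing relations  w a (x) e - w (x) a e.  [teq s s'] is
   equality of s and s' in E (x)_{A_N} E. *)
Definition inEE (s : seq (BH * BH)) : Prop :=
  forall q, q \in s -> inOmega1 q.1 /\ inOmega1 q.2.
Definition tval (s : seq (BH * BH)) : 'M[C]_(Hdim * Hdim) :=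
  \sum_(q <- s) (q.1 *t q.2).
Definition teq (s s' : seq (BH * BH)) : Prop :=
  exists r : seq (BH * AN * BH),
    (forall q, q \in r -> inOmega1 q.1.1 /\ inOmega1 q.2) /\
    tval s - tval s' =
      \sum_(q <- r) ((q.1.1 *m piA q.1.2) *t q.2 - q.1.1 *t (piA q.1.2 *m q.2)).

Definition tscale (c : C) (s : seq (BH * BH)) := [seq (c *: q.1, q.2) | q <- s].
Definition tlact (a : AN) (s : seq (BH * BH)) := [seq (piA a *m q.1, q.2) | q <- s].
Definition tract (s : seq (BH * BH)) (a : AN) := [seq (q.1, q.2 *m piA a) | q <- s].

(* wedge : E (x) E -> Omega^2 (value in S, to be read modulo J^2) *)
Definition wedge (s : seq (BH * BH)) : BH := \sum_(q <- s) q.1 *m q.2.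
Definition inKerWedge (s : seq (BH * BH)) : Prop := inEE s /\ inJ2 (wedge s).

(* ---------- Z(E) (x)_{Z(A_N)} A_N ---------- (same encoding) *)
Definition inZEA (s : seq (BH * AN)) : Prop := forall q, q \in s -> inZE q.1.
Definition tvalZ (s : seq (BH * AN)) : 'M[C]_(Hdim * Kdim) :=
  \sum_(q <- s) (q.1 *t q.2).
Definition teqZ (s s' : seq (BH * AN)) : Prop :=
  exists r : seq (BH * AN * AN),
    (forall q, q \in r -> inZE q.1.1 /\ inZA q.1.2) /\
    tvalZ s - tvalZ s' =
      \sum_(q <- r) ((q.1.1 *m piA q.1.2) *t q.2 - q.1.1 *t (q.1.2 *m q.2)).
Definition multZ (s : seq (BH * AN)) : BH := \sum_(q <- s) q.1 *m piA q.2.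

(* (1) the multiplication map Z(E) (x)_{Z(A)} A -> E is an isomorphism
   (it is well defined and A-linear by construction; bijectivity:) *)
Definition mult_iso : Prop :=
  (forall w, inOmega1 w -> exists s, inZEA s /\ multZ s = w) /\
  (forall s s', inZEA s -> inZEA s' -> multZ s = multZ s' -> teqZ s s').

(* F is a right A_N-submodule of E (x)_{A_N} E (a subset of the quotient,
   hence saturated for teq) *)
Definition right_submodule (F : seq (BH * BH) -> Prop) : Prop :=
  (forall s, F s -> inEE s) /\
  (forall s s', inEE s' -> teq s s' -> F s -> F s') /\
  F [::] /\
  (forall s s', F s -> F s' -> F (s ++ s')) /\
  (forall c s, F s -> F (tscale c s)) /\
  (forall s a, F s -> F (tract s a)).

Definition direct_sum_ker (F : seq (BH * BH) -> Prop) : Prop :=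
  (forall s, inEE s -> exists k f, inKerWedge k /\ F f /\ teq s (k ++ f)) /\
  (forall s, inKerWedge s -> F s -> teq s [::]).

(* wedge restricted to F is an isomorphism F -> Omega^2(A_N)
   (it is a right module map by construction; bijectivity:) *)
Definition wedge_F_iso (F : seq (BH * BH) -> Prop) : Prop :=
  (forall f f', F f -> F f' -> inJ2 (wedge f - wedge f') -> teq f f') /\
  (forall x, inSprod x -> exists f, F f /\ inJ2 (wedge f - x)).

(* sigma represents 2 P_sym - 1, P_sym the idempotent with image ker(wedge) and
   kernel F:  if s = k + f then sigma s = k - f *)
Definition is_sigma (F : seq (BH * BH) -> Prop) (sigma : seq (BH * BH) -> seq (BH * BH)) :
  Prop :=
  forall s, inEE s -> inEE (sigma s) /\
    exists k f, inKerWedge k /\ F f /\ teq s (k ++ f) /\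
                teq (sigma s) (k ++ tscale (-1) f).

Definition gext (g0 : BH -> BH -> AN) (s : seq (BH * BH)) : AN :=
  \sum_(q <- s) g0 q.1 q.2.

Definition is_rhom (phi : BH -> AN) : Prop :=
  [/\ forall e e', inOmega1 e -> inOmega1 e' -> phi (e + e') = phi e + phi e',
      forall (c : C) e, inOmega1 e -> phi (c *: e) = c *: phi e &
      forall e a, inOmega1 e -> phi (e *m piA a) = phi e *m a].

Definition pR_metric (sigma : seq (BH * BH) -> seq (BH * BH)) (g0 : BH -> BH -> AN) :
  Prop :=
  [/\
      forall s s', inEE s -> inEE s' -> teq s s' -> gext g0 s = gext g0 s',
      forall a e e', inOmega1 e -> inOmega1 e' ->
        g0 (piA a *m e) e' = a *m g0 e e' /\ g0 e (e' *m piA a) = g0 e e' *m a,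
      forall s, inEE s -> gext g0 (sigma s) = gext g0 s,
      forall e e', inOmega1 e -> inOmega1 e' -> (forall x, inOmega1 x -> g0 e x = g0 e' x) -> e = e' &
      forall phi, is_rhom phi -> exists e, inOmega1 e /\ forall x, inOmega1 x -> phi x = g0 e x].

Definition connection (nab : BH -> seq (BH * BH)) : Prop :=
  [/\ forall w, inOmega1 w -> inEE (nab w),
      forall w w', inOmega1 w -> inOmega1 w' -> teq (nab (w + w')) (nab w ++ nab w'),
      forall (c : C) w, inOmega1 w -> teq (nab (c *: w)) (tscale c (nab w)) &
      forall w a, inOmega1 w -> teq (nab (w *m piA a)) (tract (nab w) a ++ [:: (w, dD (piA a))])].

(* wedge o nab + d = 0, where d(sum a_j [D,b_j]) = [sum [D,a_j][D,b_j]] *)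
Definition torsionless (nab : BH -> seq (BH * BH)) : Prop :=
  forall s : seq (AN * AN),
    inJ2 (wedge (nab (\sum_(q <- s) piA q.1 *m dD (piA q.2)))
          + \sum_(q <- s) dD (piA q.1) *m dD (piA q.2)).

(* (g (x) id)(sigma_23(nab w (x) e) + w (x) nab e) = d(g(w (x) e)) on Z(E), with
   (g (x) id)(x (x) y (x) z) = g(x (x) y) z *)
Definition compatible (sigma : seq (BH * BH) -> seq (BH * BH)) (g0 : BH -> BH -> AN)
  (nab : BH -> seq (BH * BH)) : Prop :=
  forall w e, inZE w -> inZE e ->
    \sum_(q <- nab w) \sum_(r <- sigma [:: (q.2, e)]) piA (g0 q.1 r.1) *m r.2
    + \sum_(q <- nab e) piA (g0 w q.1) *m q.2
    = dD (piA (g0 w e)).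

End FuzzySphere.

(* Main.v *)
Require Import Defs.
From HB Require Import structures.
From mathcomp Require Import all_boot all_algebra.
From mathcomp Require Import complex mxtens.
From mathcomp Require Import Rstruct.
From mathcomp Require Import ring.

Set Implicit Arguments.
Unset Strict Implicit.
Unset Printing Implicit Defensive.

Import GRing.Theory Num.Theory.
Local Open Scope ring_scope.

(* The A_N-bimodule Omega^1 is free on the central elements  frame k = 1 (x) sig k:
   since 1, X_1, X_2, X_3 are linearly independent, suitable sums  sum a_j [D, b_j]
   (built from matrix units and a functional dual to X_k) produce each frame k.
   A further functional, killing 1 and the X_k but not the Casimir sum_k X_k^2, shows
   J^2 = A_N (x) 1; hence wedge is antisymmetrisation in the coordinates t_ij of
   sum_ij (frame i (x) frame j) t_ij, F consists of the antisymmetric tensors, and sigma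
   is the flip.  A metric is given by a symmetric invertible scalar matrix G, and
   torsion-freeness and compatibility of  nabla (frame k) = sum_ij (frame i (x) frame j)
   Gamma^k_ij  become  Gamma^k_ij - Gamma^k_ji = eps_ijk  and antisymmetry in (k, l) of
   (G Gamma^k)_lm, which the Koszul formula solves uniquely. *)

(** The functionals are Z |-> tr(L Z) with L supported on the blocks n = 0 and n = 1, both present
    because N >= 1. They enter the calculus through sum_ip E_ip L Z E_pi = tr(L Z) 1: with a = E_ip
    L, b = E_pi and tr L = 0, the coordinates of sum a [D, b] are the scalars tr(L X_k). That J^2 is
    no larger than A_N (x) 1 comes from the Jacobi identity: the antisymmetric part of sum da (x) db
    depends only on sum a db and vanishes with it. The Casimir appears because, when sum a db = 0,
    the component of sum da db along 1 equals the sum of the a [X_k, [X_k, b]]. Both quotients, E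
    (x) E and Omega^2, are given by existential relations on lists and matrices. The coordinates
    [co2] and [co] turn out to be complete invariants for [teq] and [inJ2], which leaves linear
    algebra in coordinates. The centre of A_N is C, so central forms have scalar coordinates and g
    is scalar on them: this gives the flip formula and makes compatibility a system with complex
    coefficients. *)

(** * The Levi-Civita symbol and the Pauli algebra *)

Lemma ord3_ind (P : 'I_3 -> Prop) : P k1 -> P k2 -> P k3 -> forall i, P i.
Proof.
move=> P1 P2 P3 [[|[|[|i]]] // lt_i3].
- by have -> : Ordinal lt_i3 = k1 by apply: val_inj.
- by have -> : Ordinal lt_i3 = k2 by apply: val_inj.
- by have -> : Ordinal lt_i3 = k3 by apply: val_inj.
Qed.

Lemma sum_ord3 (V : nmodType) (F : 'I_3 -> V) :
  \sum_(k < 3) F k = F k1 + F k2 + F k3.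
Proof.
rewrite !big_ord_recl big_ord0 addr0 addrA.
by congr (F _ + F _ + F _); apply: val_inj.
Qed.

(* The Levi-Civita symbol, as a Vandermonde product. *)
Definition eps (i j k : 'I_3) : C :=
  ((j%:R - i%:R) * (k%:R - j%:R) * (k%:R - i%:R)) / 2%:R.

Lemma epsE i j k :
  eps i j k = if uniq [:: i; j; k] then (-1) ^+ ((i > j) + (j > k) + (i > k)) else 0.
Proof.
by move: i j k; do 3 ![apply: ord3_ind]; rewrite /eps /= ?expr0 ?expr1 ?expr2 ?exprS; field.
Qed.

Lemma eps_swap i j k : eps j i k = - eps i j k.
Proof. by rewrite /eps; ring. Qed.

Lemma iC_sqr : iC * iC = -1.
Proof. by apply/eqP; rewrite eq_complex /=; apply/andP; split; apply/eqP; ring. Qed.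

Lemma mulmx_sig i j :
  sig i *m sig j = - (i == j)%:R%:M - \sum_k eps i j k *: sig k.
Proof.
apply/matrixP => a b; rewrite sum_ord3 !mxE !big_ord_recl big_ord0.
rewrite !mxE !epsE.
have E := iC_sqr.
move: i j; do 2 ![apply: ord3_ind];
  case: a => [[|[|a]] // lta]; case: b => [[|[|b]] // ltb] /=; ring: E.
Qed.

Lemma mxtrace_sig i : \tr (sig i) = 0.
Proof.
by rewrite /mxtrace !big_ord_recl big_ord0 !mxE; move: i; apply: ord3_ind => /=; ring.
Qed.

(** * Partial traces and Kronecker products *)

Section PartialTrace.
Variables (n p : nat).

(** This is w |-> (id (x) tr)(w (1 (x) B)), the partial trace over the second factor weighted by
    B. *)
Definition ptr (B : 'M[C]_p) (w : 'M[C]_(n * p)) : 'M[C]_n :=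
  \matrix_(i, j) \sum_a \sum_b
     w (mxtens_index (i, a)) (mxtens_index (j, b)) * B b a.

Lemma ptr_is_linear B : linear (ptr B).
Proof.
move=> c u v; apply/matrixP => i j; rewrite !mxE mulr_sumr -big_split /=.
apply: eq_bigr => a _; rewrite mulr_sumr -big_split /=.
by apply: eq_bigr => b _; rewrite !mxE mulrDl mulrA.
Qed.

HB.instance Definition _ B :=
  GRing.isLinear.Build C 'M[C]_(n * p) 'M[C]_n _ (ptr B) (ptr_is_linear B).

Lemma ptr_tens B (a : 'M[C]_n) (s : 'M[C]_p) : ptr B (a *t s) = \tr (s *m B) *: a.
Proof.
apply/matrixP => i j; rewrite !mxE /mxtrace mulr_suml.
apply: eq_bigr => x _; rewrite !mxE mulr_suml; apply: eq_bigr => y _.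
by rewrite tensmxE; ring.
Qed.

Lemma tensmxDl (a b : 'M[C]_n) (s : 'M[C]_p) : (a + b) *t s = a *t s + b *t s.
Proof. by apply/matrixP => i j; rewrite !mxE mulrDl. Qed.

Lemma tensmxDr (a : 'M[C]_n) (s t : 'M[C]_p) : a *t (s + t) = a *t s + a *t t.
Proof. by apply/matrixP => i j; rewrite !mxE mulrDr. Qed.

Lemma tensmxZl c (a : 'M[C]_n) (s : 'M[C]_p) : (c *: a) *t s = c *: (a *t s).
Proof. by apply/matrixP => i j; rewrite !mxE mulrA. Qed.

Lemma tensmxZr c (a : 'M[C]_n) (s : 'M[C]_p) : a *t (c *: s) = c *: (a *t s).
Proof. by apply/matrixP => i j; rewrite !mxE mulrCA. Qed.

Lemma tensmx_suml I r (P : pred I) (F : I -> 'M[C]_n) (s : 'M[C]_p) :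
  (\sum_(i <- r | P i) F i) *t s = \sum_(i <- r | P i) F i *t s.
Proof.
apply: (big_morph (fun x => x *t s)) => [x y|]; first exact: tensmxDl.
exact: tens0mx.
Qed.

Lemma tensmx_sumr I r (P : pred I) (F : I -> 'M[C]_p) (a : 'M[C]_n) :
  a *t (\sum_(i <- r | P i) F i) = \sum_(i <- r | P i) a *t F i.
Proof.
apply: (big_morph (fun x => a *t x)) => [x y|]; first exact: tensmxDr.
exact: tensmx0.
Qed.

(** Weighting by [delta_mx b a] extracts the (a, b) block of the second factor. Linear identities
    can thus be checked on elementary tensors. *)
Lemma tens_decomp (w : 'M[C]_(n * p)) :
  w = \sum_a \sum_b ptr (delta_mx b a) w *t delta_mx a b.
Proof.
apply/matrixP => i j.
case: (mxtens_indexP i) => i0 i1; case: (mxtens_indexP j) => j0 j1 {i j}.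
rewrite !summxE (bigD1 i1) //= [X in _ + X]big1 ?addr0 => [|a /negPf na]; last first.
  rewrite summxE big1 // => b _.
  by rewrite tensmxE [delta_mx a b _ _]mxE eq_sym na mulr0.
rewrite summxE (bigD1 j1) //= [X in _ + X]big1 ?addr0 => [|b /negPf nb]; last first.
  by rewrite tensmxE [delta_mx i1 b _ _]mxE [j1 == b]eq_sym nb andbF mulr0.
rewrite tensmxE !mxE !eqxx mulr1 (bigD1 i1) //= [X in _ + X]big1 ?addr0.
  rewrite (bigD1 j1) //= [X in _ + X]big1 ?addr0 ?mxE ?eqxx ?mulr1 // => b /negPf nb.
  by rewrite mxE nb mulr0.
by move=> a /negPf na; rewrite big1 // => b _; rewrite mxE na andbF mulr0.
Qed.

Lemma ptr_mull B (a : 'M[C]_n) (w : 'M[C]_(n * p)) :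
  ptr B ((a *t 1%:M) *m w) = a *m ptr B w.
Proof.
rewrite [w in RHS]tens_decomp [w in LHS]tens_decomp.
rewrite mulmx_sumr !raddf_sum /= ; apply: eq_bigr => x _.
rewrite mulmx_sumr !raddf_sum /= ; apply: eq_bigr => y _.
by rewrite tensmx_mul mul1mx !ptr_tens scalemxAr.
Qed.

Lemma ptr_mulr B (a : 'M[C]_n) (w : 'M[C]_(n * p)) :
  ptr B (w *m (a *t 1%:M)) = ptr B w *m a.
Proof.
rewrite [w in RHS]tens_decomp [w in LHS]tens_decomp.
rewrite mulmx_suml !raddf_sum mulmx_suml /= ; apply: eq_bigr => x _.
rewrite mulmx_suml !raddf_sum mulmx_suml /= ; apply: eq_bigr => y _.
by rewrite tensmx_mul mulmx1 !ptr_tens scalemxAl.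
Qed.

End PartialTrace.

Lemma ord2_ind (P : 'I_2 -> Prop) : P ord0 -> P (lift ord0 ord0) -> forall i, P i.
Proof.
move=> P0 P1 [[|[|i]] // lt_i2].
  by have -> : Ordinal lt_i2 = ord0 by apply: val_inj.
by have -> : Ordinal lt_i2 = lift ord0 ord0 by apply: val_inj.
Qed.

Lemma sum_ord2 (V : nmodType) (F : 'I_2 -> V) :
  \sum_(k < 2) F k = F ord0 + F (lift ord0 ord0).
Proof. by rewrite !big_ord_recl big_ord0 addr0. Qed.

Lemma spin_decomp (s : 'M[C]_2) :
  s = (\tr s / 2%:R)%:M - \sum_k (\tr (s *m sig k) / 2%:R) *: sig k.
Proof.
apply/matrixP => a b.
(* The prefactor [iC] of [sig] is kept as a variable c, so that it enters only through c * c. *)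
have entryE (c : C) (t : 'I_3 -> 'M[C]_2) :
    ((\tr s / 2%:R)%:M - \sum_k (\tr (s *m (c *: t k)) / 2%:R) *: (c *: t k)) a b =
    (s ord0 ord0 + s (lift ord0 ord0) (lift ord0 ord0)) / 2%:R *+ (a == b)
    - \sum_k ((s ord0 ord0 * t k ord0 ord0
        + s ord0 (lift ord0 ord0) * t k (lift ord0 ord0) ord0
        + (s (lift ord0 ord0) ord0 * t k ord0 (lift ord0 ord0)
        + s (lift ord0 ord0) (lift ord0 ord0) * t k (lift ord0 ord0) (lift ord0 ord0)))
          / 2%:R) * (c * c) * t k a b.
  rewrite !mxE summxE /mxtrace sum_ord2; congr (_ - _); apply: eq_bigr => k _.
  by rewrite mxE !sum_ord2 !mxE !sum_ord2 !mxE; ring.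
rewrite entryE iC_sqr sum_ord3.
clear entryE; move: a b; apply: ord2_ind; apply: ord2_ind;
  rewrite /tau ![(\matrix_(_, _) _) _ _]mxE /= ?mulr1n ?mulr0n;
  move: (s (lift _ _) (lift _ _)) (s (lift _ _) ord0) (s ord0 (lift _ _))
    (s ord0 ord0) => s00 s01 s10 s11; by field: iC_sqr.
Qed.

(** * The trace form of an irreducible representation of su(2) *)

Section SU2.
Variables (n : nat) (rho : 'I_3 -> 'M[C]_n).
Hypothesis rhoP : su2_irrep rho.

Lemma su2_comm i j : commx (rho i) (rho j) = \sum_k eps i j k *: rho k.
Proof.
case: rhoP => _ r12 r23 r31 _.
have commN A B : commx A B = - commx B A :> 'M[C]_n by rewrite opprB.
have comm0 A : commx A A = 0 :> 'M[C]_n by rewrite /commx subrr.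
move: i j; do 2 ![apply: ord3_ind]; rewrite sum_ord3 !epsE /=
  ?expr0 ?expr1 ?exprS ?mul1r ?mulr1 ?mulrNN ?scale0r ?addr0 ?add0r
  ?mul1r ?scaleN1r ?scale1r ?comm0 //.
- by rewrite commN r31.
- by rewrite commN r12.
- by rewrite commN r23 mulr1 scaleN1r.
Qed.

Lemma su2_trace i : \tr (rho i) = 0.
Proof.
have tr0 A B : \tr (commx A B : 'M[C]_n) = 0.
  by rewrite /commx raddfB /= mxtrace_mulC subrr.
by case: rhoP => _ r12 r23 r31 _; move: i; apply: ord3_ind; rewrite -?r12 -?r23 -?r31.
Qed.

(* The trace form is ad-invariant. *)
Lemma su2_trace_mul i j : \tr (rho i *m rho j) = \tr (rho k1 *m rho k1) *+ (i == j).
Proof.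
have inv A B D : \tr (commx A B *m D) = \tr (A *m commx B D) :> C.
  rewrite /commx mulmxBl mulmxBr !raddfB /=; congr (_ - _).
    by rewrite mulmxA.
  by rewrite -[B *m A *m D]mulmxA mxtrace_mulC mulmxA.
have symm A B : \tr (A *m B) = \tr (B *m A) :> C by rewrite mxtrace_mulC.
have comm0 A : commx A A = 0 :> 'M[C]_n by rewrite /commx subrr.
have tr12 : \tr (rho k1 *m rho k2) = 0.
  by case: rhoP => _ _ _ <- _; rewrite symm inv comm0 mulmx0 mxtrace0.
have tr23 : \tr (rho k2 *m rho k3) = 0.
  by case: rhoP => _ <- _ _ _; rewrite symm inv comm0 mulmx0 mxtrace0.
have tr31 : \tr (rho k3 *m rho k1) = 0.
  by case: rhoP => _ _ <- _ _; rewrite symm inv comm0 mulmx0 mxtrace0.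
case: rhoP => _ r12 r23 r31 _.
have tr33 : \tr (rho k3 *m rho k3) = \tr (rho k1 *m rho k1).
  by rewrite -{1}r12 inv r23.
have tr22 : \tr (rho k2 *m rho k2) = \tr (rho k1 *m rho k1).
  by apply/esym; rewrite -{1}r23 inv r31.
move: i j; do 2 ![apply: ord3_ind]; [by [] | exact: tr12 | rewrite symm; exact: tr31
  | rewrite symm; exact: tr12 | exact: tr22 | exact: tr23
  | exact: tr31 | rewrite symm; exact: tr23 | exact: tr33].
Qed.

End SU2.

(** By skew-Hermiticity this trace is minus the sum of the squared moduli of the entries of
    [rho k1]. If it vanished, so would [rho k1], hence by the brackets all generators; every line
    would then be invariant, against irreducibility in dimension at least 2. *)
Lemma su2_killing_neq0 n (rho : 'I_3 -> 'M[C]_n.+2) :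
  su2_irrep rho -> \tr (rho k1 *m rho k1) != 0.
Proof.
case=> skew r12 r23 r31 irr; apply/eqP => tr0.
have rho1 : rho k1 = 0.
  have : \tr (rho k1 *m adjmx (rho k1)) = 0 by rewrite skew mulmxN raddfN /= tr0 oppr0.
  rewrite /mxtrace => /eqP; rewrite psumr_eq0 => [|i _]; last first.
    by rewrite mxE sumr_ge0 // => j _; rewrite !mxE mul_conjC_ge0.
  move=> /allP z; apply/matrixP => i j; rewrite [RHS]mxE.
  have := z i (mem_index_enum i); rewrite /= mxE psumr_eq0 => [|k _]; last first.
    by rewrite !mxE mul_conjC_ge0.
  move=> /allP/(_ j (mem_index_enum j)); rewrite /= !mxE mul_conjC_eq0.
  by move/eqP.
have rho3 : rho k3 = 0 by rewrite -r12 /commx rho1 mul0mx mulmx0 subrr.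
have rho2 : rho k2 = 0 by rewrite -r31 /commx rho1 mul0mx mulmx0 subrr.
have rho0 k : rho k = 0 by move: k; apply: ord3_ind.
have stable0 k : ((delta_mx 0 0 : 'M[C]_n.+2) *m (rho k)^T <= (delta_mx 0 0 : 'M[C]_n.+2))%MS.
  by rewrite rho0 trmx0 mulmx0 sub0mx.
by case: (irr _ stable0); rewrite mxrank_delta.
Qed.

Lemma su2_irrep1 (rho : 'I_3 -> 'M[C]_1) i : su2_irrep rho -> rho i = 0.
Proof.
case=> _ r12 r23 r31 _.
have comm0 (A B : 'M[C]_1) : commx A B = 0.
  by rewrite /commx [A]mx11_scalar [B]mx11_scalar -!scalar_mxM mulrC subrr.
by move: i; apply: ord3_ind; rewrite -?r12 -?r23 -?r31 comm0.
Qed.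

(** * Block-diagonal operators and functionals separating 1, the X_k and the Casimir *)

Section BlockDiagonal.
Variables (p : nat) (d : 'I_p -> nat).

Lemma mul_mxdiag (A B : forall i, 'M[C]_(d i)) :
  \mxdiag_i A i *m \mxdiag_i B i = \mxdiag_i (A i *m B i).
Proof.
rewrite {1}/mxdiag mul_mxblock_mxdiag; apply/eq_mxblock => i j.
by case: eqVneq => [->|_]; rewrite ?conform_mx_id ?mul0mx.
Qed.

Lemma scale_mxdiag c (A : forall i, 'M[C]_(d i)) :
  c *: \mxdiag_i A i = \mxdiag_i (c *: A i).
Proof.
rewrite -mul_scalar_mx -mxdiagZ mul_mxdiag.
by apply: eq_mxdiag => i; rewrite mul_scalar_mx.
Qed.

End BlockDiagonal.

Section Functionals.
Variables (N : nat) (rho : forall n : 'I_N.+1, 'I_3 -> 'M[C]_n.+1).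
Hypothesis N_gt0 : (1 <= N)%N.
Hypothesis rhoP : forall n : 'I_N.+1, su2_irrep (rho n).
Local Notation X := (Xop rho).

Lemma Xop_comm i j : X i *m X j - X j *m X i = \sum_k eps i j k *: X k.
Proof.
rewrite /Xop !mul_mxdiag -mxdiagB.
under [RHS]eq_bigr do rewrite scale_mxdiag.
rewrite -mxdiag_sum; apply: eq_mxdiag => n; exact: su2_comm.
Qed.

Let blk1 : 'I_N.+1 := Ordinal (N_gt0 : 1 < N.+1)%N.

(** The generators are orthogonal for the trace form. So L is [rho blk1 k] on the spin-1/2 block,
    divided by the common value K of tr(rho_j^2) there, and zero on the other blocks. *)
Lemma Xop_dual k : exists L : 'M[C]_(Kdim N),
  \tr L = 0 /\ forall j, \tr (L *m X j) = (k == j)%:R.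
Proof.
have K0 := @su2_killing_neq0 0 (rho blk1) (rhoP blk1).
set K := \tr _ in K0.
exists (\mxdiag_n ((K^-1 *+ (n == blk1)) *: rho n k)); split=> [|j].
  by rewrite mxtrace_mxdiag big1 // => n _; rewrite mxtraceZ (su2_trace (rhoP n)) mulr0.
rewrite /Xop mul_mxdiag mxtrace_mxdiag (bigD1 blk1) //= big1 => [|n /negPf ->].
  by rewrite mulr1n -scalemxAl mxtraceZ (su2_trace_mul (rhoP blk1)) addr0 -/K mulrnAr mulVf.
by rewrite mulr0n scale0r mul0mx mxtrace0.
Qed.

Lemma Casimir_dual : exists L : 'M[C]_(Kdim N),
  [/\ \tr L = 0, forall j, \tr (L *m X j) = 0 & \tr (L *m \sum_k X k *m X k) = 1].
Proof.
have K0 := @su2_killing_neq0 0 (rho blk1) (rhoP blk1).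
set K := \tr _ in K0.
have blk10 : (ord0 == blk1) = false by [].
(* The weights 1 on the two-dimensional block and -2 on the one-dimensional block give total trace 2
   - 2 = 0. The Casimir has trace 3K on the former and 0 on the latter, whence the factor
   (3K)^-1. *)
pose c (n : 'I_N.+1) : C := (3%:R * K)^-1 * ((n == blk1)%:R - 2%:R * (n == ord0)%:R).
have c0 n : (n != ord0) && (n != blk1) -> c n = 0.
  by case/andP=> /negPf n0 /negPf n1; rewrite /c n0 n1 mulr0 subr0 mulr0.
exists (\mxdiag_n (c n)%:M); split=> [|j|].
- rewrite mxtrace_mxdiag (bigD1 ord0) // (bigD1 blk1) //= big1 => [|n].
    rewrite !mxtrace_scalar /c !eqxx blk10 eq_sym blk10 /=.
    by rewrite mulr1n mulr2n; ring.
  by move/c0 ->; rewrite mxtrace_scalar mul0rn.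
- rewrite /Xop mul_mxdiag mxtrace_mxdiag big1 // => n _.
  by rewrite mul_scalar_mx mxtraceZ (su2_trace (rhoP n)) mulr0.
under eq_bigr do rewrite mul_mxdiag.
have cas0 : \tr (\sum_k rho ord0 k *m rho ord0 k) = 0.
  rewrite big1 ?mxtrace0 // => i _.
  by rewrite (@su2_irrep1 (rho ord0) i (rhoP ord0)) mul0mx.
have cas1 : \tr (\sum_k rho blk1 k *m rho blk1 k) = 3%:R * K.
  have trK i : \tr (rho blk1 i *m rho blk1 i) = K.
    by rewrite (su2_trace_mul (rhoP blk1)) eqxx.
  by rewrite sum_ord3 2!mxtraceD (trK k1) (trK k2) (trK k3); ring.
rewrite -mxdiag_sum mul_mxdiag mxtrace_mxdiag.
rewrite (bigD1 ord0) // (bigD1 blk1) //= [X in _ + (_ + X)]big1 => [|n].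
  rewrite !mul_scalar_mx !mxtraceZ cas0 cas1 /c eqxx [blk1 == ord0]eq_sym blk10 /=.
  by field; rewrite K0.
by move/c0 ->; rewrite mul_scalar_mx scale0r mxtrace0.
Qed.

End Functionals.

(** * Antisymmetrisation, and traces as sandwich sums *)

Lemma eps_sum_eq0 (V : lmodType C) (t : 'I_3 -> 'I_3 -> V) :
  (forall k, \sum_i \sum_j eps i j k *: t i j = 0) <-> (forall i j, t i j = t j i).
Proof.
have epsV k : \sum_i \sum_j eps i j k *: t i j =
    if k == k1 then t k2 k3 - t k3 k2
    else if k == k2 then t k3 k1 - t k1 k3 else t k1 k2 - t k2 k1.
  rewrite !sum_ord3 !epsE; move: k; apply: ord3_ind; rewrite /=
    !(expr0, exprS, mulr1, mulrNN, scale0r, scale1r, scaleN1r, addr0, add0r) //.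
  by rewrite addrC.
split=> [t0|tC k]; last first.
  by rewrite epsV (tC k2 k3) (tC k3 k1) (tC k1 k2) !subrr;
  case: (k == k1); case: (k == k2).
have := t0 k1; have := t0 k2; have := t0 k3; rewrite !epsV /=.
move=> /subr0_eq t12 /subr0_eq t31 /subr0_eq t23.
by move=> i j; move: i j; do 2 ![apply: ord3_ind].
Qed.

Lemma mxtrace_mulmx_sig i j : \tr (sig i *m sig j) = - ((i == j)%:R *+ 2).
Proof.
have tr0 : \tr (\sum_k eps i j k *: sig k) = 0.
  by rewrite raddf_sum big1 // => k _; rewrite /= mxtraceZ mxtrace_sig mulr0.
by rewrite mulmx_sig mxtraceD !raddfN /= tr0 oppr0 addr0 mxtrace_scalar.
Qed.

(** Since E_ip M E_pi = M_pp E_ii, summing over p forms the trace and summing over i forms the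
    identity. *)
Lemma sum_delta_sandwich n (L Z : 'M[C]_n) :
  \sum_(i < n) \sum_(p < n) (delta_mx i p *m L) *m Z *m delta_mx p i = (\tr (L *m Z))%:M.
Proof.
have deltaE (i p : 'I_n) (M : 'M[C]_n) :
    delta_mx i p *m M *m delta_mx p i = M p p *: delta_mx i i.
  have E : delta_mx 0 p *m M *m delta_mx p 0 = (M p p)%:M :> 'M[C]_1.
    by rewrite [LHS]mx11_scalar -rowE -colE !mxE.
  rewrite -(mul_delta_mx (0 : 'I_1) i p) -(mul_delta_mx (0 : 'I_1) p i).
  transitivity (delta_mx i (0 : 'I_1) *m (delta_mx 0 p *m M *m delta_mx p 0)
    *m delta_mx (0 : 'I_1) i : 'M[C]_n).
    by rewrite !mulmxA.
  by rewrite E mul_mx_scalar -scalemxAl mul_delta_mx.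
transitivity (\sum_i \tr (L *m Z) *: delta_mx i i : 'M[C]_n).
  apply: eq_bigr => i _; rewrite /mxtrace scaler_suml; apply: eq_bigr => p _.
  by rewrite -(mulmxA (delta_mx i p)) deltaE.
rewrite -scaler_sumr -scalemx1; congr (_ *: _).
apply/matrixP => a b; rewrite summxE mxE (bigD1 a) //= big1 => [|i /negPf ia].
  by rewrite mxE eqxx addr0 andTb eq_sym.
by rewrite mxE eq_sym ia.
Qed.

(** * Coordinates on B(H_N) and the one-forms *)

Section Calculus.
Variables (N : nat) (rho : forall n : 'I_N.+1, 'I_3 -> 'M[C]_n.+1).
Hypothesis N_gt0 : (1 <= N)%N.
Hypothesis rhoP : forall n : 'I_N.+1, su2_irrep (rho n).
Local Notation X := (Xop rho).
Local Notation AN := 'M[C]_(Kdim N).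
Local Notation BH := 'M[C]_(Hdim N).
Local Notation Omega1 := (inOmega1 rho).
Local Notation d := (dD rho).

(* The coordinates in  B(H_N) = A_N (x) span(1, sig k1, sig k2, sig k3)  are sealed:
   unfolding them while comparing distinct indices makes unification diverge. *)
Fact co0_seal : {f : BH -> AN | f = @ptr (Kdim N) 2 (2%:R^-1)%:M}.
Proof. by exists (@ptr (Kdim N) 2 (2%:R^-1)%:M). Qed.
Definition co0 : BH -> AN := sval co0_seal.
Lemma co0E w : co0 w = @ptr (Kdim N) 2 (2%:R^-1)%:M w.
Proof. by rewrite /co0 (svalP co0_seal). Qed.

(** As tr(sig_k sig_j) = -2 delta_kj, the factor -1/2 makes [co k] read off the coefficient of
    [sig k]. *)
Fact co_seal : {f : 'I_3 -> BH -> AN | f = fun k => @ptr (Kdim N) 2 (- 2%:R^-1 *: sig k)}.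
Proof. by exists (fun k => @ptr (Kdim N) 2 (- 2%:R^-1 *: sig k)). Qed.
Definition co : 'I_3 -> BH -> AN := sval co_seal.
Lemma coE k w : co k w = @ptr (Kdim N) 2 (- 2%:R^-1 *: sig k) w.
Proof. by rewrite /co (svalP co_seal). Qed.

Lemma co0_is_linear : linear co0.
Proof. by move=> c u v; rewrite !co0E linearP. Qed.
Lemma co_is_linear k : linear (co k).
Proof. by move=> c u v; rewrite !coE linearP. Qed.
HB.instance Definition _ := GRing.isLinear.Build C BH AN _ co0 co0_is_linear.
HB.instance Definition _ k := GRing.isLinear.Build C BH AN _ (co k) (co_is_linear k).

Definition frame (k : 'I_3) : BH := (1%:M : AN) *t sig k.

Let half2 : 2%:R^-1 *+ 2 = 1 :> C. Proof. by field. Qed.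

Lemma co_piA k a : co k (piA a) = 0.
Proof.
by rewrite coE /piA ptr_tens mul1mx mxtraceZ mxtrace_sig mulr0 scale0r.
Qed.

Lemma co0_piA a : co0 (piA a) = a.
Proof. by rewrite co0E /piA ptr_tens mul1mx mxtrace_scalar half2 scale1r. Qed.

Lemma co_sig k a j : co k (a *t sig j) = (k == j)%:R *: a.
Proof.
rewrite coE ptr_tens -scalemxAr mxtraceZ mxtrace_mulmx_sig mulrNN.
by rewrite mulrnAr -mulrnAl half2 mul1r eq_sym.
Qed.

Lemma co0_sig a j : co0 (a *t sig j) = 0.
Proof. by rewrite co0E ptr_tens mul_mx_scalar mxtraceZ mxtrace_sig mulr0 scale0r. Qed.

Lemma co_mull k a w : co k (piA a *m w) = a *m co k w.
Proof. by rewrite !coE; exact: ptr_mull. Qed.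

Lemma co_mulr k a w : co k (w *m piA a) = co k w *m a.
Proof. by rewrite !coE; exact: ptr_mulr. Qed.

Lemma co0_mull a w : co0 (piA a *m w) = a *m co0 w.
Proof. by rewrite !co0E; exact: ptr_mull. Qed.

Lemma co0_mulr a w : co0 (w *m piA a) = co0 w *m a.
Proof. by rewrite !co0E; exact: ptr_mulr. Qed.

Lemma piA_mul (a b : AN) : piA a *m piA b = piA (a *m b).
Proof. by rewrite /piA tensmx_mul mulmx1. Qed.

Lemma co_decomp w : w = piA (co0 w) + \sum_k co k w *t sig k.
Proof.
have tensP a s : a *t s = piA (co0 (a *t s)) + \sum_k co k (a *t s) *t sig k.
  rewrite co0E ptr_tens mul_mx_scalar mxtraceZ.
  under eq_bigr do rewrite coE ptr_tens -scalemxAr mxtraceZ tensmxZl -tensmxZr.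
  rewrite /piA tensmxZl -tensmxZr -tensmx_sumr -tensmxDr; congr (_ *t _).
  rewrite [LHS]spin_decomp scalemx1 mulrC; congr (_ + _).
  by rewrite -sumrN; apply: eq_bigr => k _; rewrite mulNr scaleNr mulrC.
pose P u := u = piA (co0 u) + \sum_k co k u *t sig k.
have PD u v : P u -> P v -> P (u + v).
  rewrite /P => {1}-> {1}->; rewrite [co0 (u + v)]raddfD /piA tensmxDl addrACA.
  congr (_ + _); rewrite -big_split; apply: eq_bigr => k _ /=.
  by rewrite raddfD tensmxDl.
have P0 : P 0.
  rewrite /P [co0 0]raddf0 /piA tens0mx add0r big1 // => k _.
  by rewrite raddf0 tens0mx.
rewrite -/(P w) (@tens_decomp (Kdim N) 2 w).
by apply: (big_ind P) => // a _; apply: (big_ind P) => // b _; exact: tensP.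
Qed.

Lemma eq_coP u v : co0 u = co0 v -> (forall k, co k u = co k v) -> u = v.
Proof.
move=> e0 e; rewrite (co_decomp u) (co_decomp v) e0.
by congr (_ + _); apply: eq_bigr => k _; rewrite e.
Qed.

Lemma dD_piA b : d (piA b) = \sum_k (X k *m b - b *m X k) *t sig k.
Proof.
rewrite /dD /DN mulmx_suml mulmx_sumr -sumrB; apply: eq_bigr => k _.
rewrite /piA !tensmx_mul mulmx1 mul1mx.
by apply/matrixP => i j; rewrite !mxE mulrBl.
Qed.

Lemma co_sum_sig j (a : 'I_3 -> AN) : co j (\sum_k a k *t sig k) = a j.
Proof.
rewrite raddf_sum (bigD1 j) //= co_sig eqxx scale1r big1 ?addr0 // => k.
by rewrite eq_sym co_sig => /negPf ->; rewrite scale0r.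
Qed.

Lemma co0_sum_sig (a : 'I_3 -> AN) : co0 (\sum_k a k *t sig k) = 0.
Proof. by rewrite raddf_sum big1 // => k _; rewrite /= co0_sig. Qed.

Lemma co_dD j b : co j (d (piA b)) = X j *m b - b *m X j.
Proof. by rewrite dD_piA co_sum_sig. Qed.

Lemma co0_dD b : co0 (d (piA b)) = 0.
Proof. by rewrite dD_piA co0_sum_sig. Qed.

Lemma dual_seq (L : AN) : exists s : seq (AN * AN),
  forall Z, \sum_(q <- s) q.1 *m Z *m q.2 = (\tr (L *m Z))%:M.
Proof.
exists [seq (delta_mx i p *m L, delta_mx p i) | i <- index_enum 'I_(Kdim N),
                                                p <- index_enum 'I_(Kdim N)].
by move=> Z; rewrite big_allpairs_dep; exact: sum_delta_sandwich.
Qed.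

(** At Z = 1 the sandwich formula gives sum a_q b_q = tr L = 0, so the terms a_q b_q Z of the
    commutators drop out. *)
Lemma sum_commutator (s : seq (AN * AN)) (L Z : AN) :
  (forall Z, \sum_(q <- s) q.1 *m Z *m q.2 = (\tr (L *m Z))%:M) -> \tr L = 0 ->
  \sum_(q <- s) q.1 *m (Z *m q.2 - q.2 *m Z) = (\tr (L *m Z))%:M.
Proof.
move=> sP trL; under eq_bigr do rewrite mulmxBr mulmxA mulmxA.
rewrite sumrB sP -mulmx_suml.
have := sP 1%:M; rewrite mulmx1 trL; under eq_bigr do rewrite mulmx1.
by move=> ->; rewrite raddf0 mul0mx subr0.
Qed.

Lemma Omega1_co0 w : Omega1 w -> co0 w = 0.
Proof.
case=> s ->; rewrite raddf_sum big1 // => q _.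
by rewrite /= co0_mull co0_dD mulmx0.
Qed.

(** For the converse, left A_N-linearity leaves only the forms [frame k] to be produced. With L from
    [Xop_dual] and its sandwich sum, sum a_q [X_j, b_q] = tr(L X_j) = delta_kj, which are the
    coordinates of [frame k]. *)
Lemma Omega1E w : Omega1 w <-> co0 w = 0.
Proof.
split=> [|w0]; first exact: Omega1_co0.
have frame_in k : exists s : seq (AN * AN),
    frame k = \sum_(q <- s) piA q.1 *m d (piA q.2).
  have [L [trL LX]] := Xop_dual N_gt0 rhoP k; have [s sP] := dual_seq L.
  exists s; apply: eq_coP => [|j].
    by rewrite co0_sig raddf_sum big1 // => q _; rewrite /= co0_mull co0_dD mulmx0.
  rewrite co_sig raddf_sum; under eq_bigr do rewrite /= co_mull co_dD.
  by rewrite (sum_commutator _ sP trL) LX eq_sym scalemx1.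
have add_in u v : Omega1 u -> Omega1 v -> Omega1 (u + v).
  by move=> [s ->] [t ->]; exists (s ++ t); rewrite big_cat.
rewrite (co_decomp w) w0 /piA tens0mx add0r.
apply: (big_ind Omega1) => [|//|k _]; first by exists [::]; rewrite big_nil.
have [s sE] := frame_in k; exists [seq (co k w *m q.1, q.2) | q <- s].
rewrite (_ : co k w *t sig k = piA (co k w) *m frame k); last first.
  by rewrite /frame tensmx_mul mulmx1 mul1mx.
rewrite sE mulmx_sumr big_map; apply: eq_bigr => q _.
by rewrite mulmxA piA_mul.
Qed.

End Calculus.

(** * Coordinates on E (x) E *)

Section TensorSquare.
Variables (N : nat) (rho : forall n : 'I_N.+1, 'I_3 -> 'M[C]_n.+1).
Hypothesis N_gt0 : (1 <= N)%N.
Hypothesis rhoP : forall n : 'I_N.+1, su2_irrep (rho n).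
Local Notation X := (Xop rho).
Local Notation AN := 'M[C]_(Kdim N).
Local Notation BH := 'M[C]_(Hdim N).
Local Notation Omega1 := (inOmega1 rho).
Local Notation d := (dD rho).
Local Notation EE := (inEE rho).

Let O1E := Omega1E N_gt0 rhoP.

Lemma Omega1D u v : Omega1 u -> Omega1 v -> Omega1 (u + v).
Proof. by rewrite !O1E raddfD /= => -> ->; rewrite addr0. Qed.

Lemma Omega1Z c u : Omega1 u -> Omega1 (c *: u).
Proof. by rewrite !O1E linearZ /= => ->; rewrite scaler0. Qed.

Lemma Omega1_mull a u : Omega1 u -> Omega1 (piA a *m u).
Proof. by rewrite !O1E co0_mull => ->; rewrite mulmx0. Qed.

Lemma Omega1_mulr a u : Omega1 u -> Omega1 (u *m piA a).
Proof. by rewrite !O1E co0_mulr => ->; rewrite mul0mx. Qed.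

Lemma Omega1_frame k : Omega1 (frame N k).
Proof. by rewrite O1E co0_sig. Qed.

Lemma Omega1_d b : Omega1 (d (piA b)).
Proof. by rewrite O1E co0_dD. Qed.

Lemma Omega1_sum_sig (a : 'I_3 -> AN) : Omega1 (\sum_k a k *t sig k).
Proof. by rewrite O1E co0_sum_sig. Qed.

Lemma Omega1_decomp w : Omega1 w -> w = \sum_k co k w *t sig k.
Proof. by rewrite O1E {2}(co_decomp w) => ->; rewrite /piA tens0mx add0r. Qed.

Lemma eq_Omega1 u v :
  Omega1 u -> Omega1 v -> (forall k, co k u = co k v) -> u = v.
Proof. by rewrite !O1E => u0 v0; apply: eq_coP; rewrite u0 v0. Qed.

Lemma co_frame k j : co k (frame N j) = (k == j)%:R%:M.
Proof. by rewrite co_sig scalemx1. Qed.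

Lemma mul_tens_sig (a b : AN) i j :
  (a *t sig i) *m (b *t sig j) = - piA ((i == j)%:R *: (a *m b))
    - \sum_k (eps i j k *: (a *m b)) *t sig k.
Proof.
have tensNr (x : AN) (s : 'M[C]_2) : x *t (- s) = - (x *t s).
  by rewrite -scaleN1r tensmxZr scaleN1r.
have tens1 (x : AN) (c : C) : x *t c%:M = piA (c *: x).
  by rewrite -scalemx1 tensmxZr -tensmxZl.
have tensS (x : AN) (c : 'I_3 -> C) :
    x *t (\sum_k c k *: sig k) = \sum_k (c k *: x) *t sig k.
  by rewrite tensmx_sumr; apply: eq_bigr => k _; rewrite tensmxZr -tensmxZl.
by rewrite tensmx_mul mulmx_sig tensmxDr 2!tensNr tens1 tensS.
Qed.

Lemma co_mul_sig k (a b : AN) i j :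
  co k ((a *t sig i) *m (b *t sig j)) = - (eps i j k *: (a *m b)).
Proof. by rewrite mul_tens_sig raddfB raddfN /= co_piA co_sum_sig oppr0 add0r. Qed.

Lemma co0_mul_sig (a b : AN) i j :
  co0 ((a *t sig i) *m (b *t sig j)) = - ((i == j)%:R *: (a *m b)).
Proof. by rewrite mul_tens_sig raddfB raddfN /= co0_piA co0_sum_sig subr0. Qed.

Lemma co_mul k u v : Omega1 u -> Omega1 v ->
  co k (u *m v) = - \sum_i \sum_j eps i j k *: (co i u *m co j v).
Proof.
move=> /Omega1_decomp {1}-> /Omega1_decomp {1}->.
rewrite mulmx_suml raddf_sum -sumrN; apply: eq_bigr => i _ /=.
rewrite mulmx_sumr raddf_sum -sumrN; apply: eq_bigr => j _ /=.
exact: co_mul_sig.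
Qed.

Lemma co0_mul u v : Omega1 u -> Omega1 v ->
  co0 (u *m v) = - \sum_i co i u *m co i v.
Proof.
move=> /Omega1_decomp {1}-> /Omega1_decomp {1}->.
rewrite mulmx_suml raddf_sum -sumrN; apply: eq_bigr => i _ /=.
rewrite mulmx_sumr raddf_sum (bigD1 i) //= (co0_mul_sig (co i u)) eqxx scale1r.
rewrite big1 ?addr0 // => j; rewrite eq_sym => /negPf ij.
by rewrite co0_mul_sig ij scale0r oppr0.
Qed.

(* Coordinates of E (x)_A E in the basis  frame i (x) frame j. *)
Fact co2_seal : {f : 'I_3 -> 'I_3 -> seq (BH * BH) -> AN |
  f = fun i j s => \sum_(q <- s) co i q.1 *m co j q.2}.
Proof. by exists (fun i j s => \sum_(q <- s) co i q.1 *m co j q.2). Qed.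
Definition co2 : 'I_3 -> 'I_3 -> seq (BH * BH) -> AN := sval co2_seal.
Lemma co2E i j s : co2 i j s = \sum_(q <- s) co i q.1 *m co j q.2.
Proof. by rewrite /co2 (svalP co2_seal). Qed.

Lemma co2_nil i j : co2 i j [::] = 0.
Proof. by rewrite co2E big_nil. Qed.

Lemma co2_cat i j s t : co2 i j (s ++ t) = co2 i j s + co2 i j t.
Proof. by rewrite !co2E big_cat. Qed.

Lemma co2_seq1 i j u v : co2 i j [:: (u, v)] = co i u *m co j v.
Proof. by rewrite co2E big_seq1. Qed.

Lemma co2_scale i j c s : co2 i j (tscale c s) = c *: co2 i j s.
Proof.
rewrite !co2E big_map scaler_sumr; apply: eq_bigr => q _.
by rewrite linearZ /= scalemxAl.
Qed.

Lemma co2_ract i j s a : co2 i j (tract s a) = co2 i j s *m a.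
Proof.
rewrite !co2E big_map mulmx_suml; apply: eq_bigr => q _.
by rewrite co_mulr mulmxA.
Qed.

Lemma EE_nil : EE [::].
Proof. by []. Qed.

Lemma EE_cat s t : EE s -> EE t -> EE (s ++ t).
Proof. by move=> sE tE q; rewrite mem_cat => /orP[/sE|/tE]. Qed.

Lemma EE_scale c s : EE s -> EE (tscale c s).
Proof. by move=> sE q /mapP[r /sE[r1 r2] ->]; split=> //; exact: Omega1Z. Qed.

Lemma EE_ract s a : EE s -> EE (tract s a).
Proof. by move=> sE q /mapP[r /sE[r1 r2] ->]; split=> //; exact: Omega1_mulr. Qed.

Lemma EE_seq1 u v : Omega1 u -> Omega1 v -> EE [:: (u, v)].
Proof. by move=> uE vE q; rewrite inE => /eqP ->. Qed.

Definition of_co2 (t : 'I_3 -> 'I_3 -> AN) : seq (BH * BH) :=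
  [seq (frame N i, \sum_j t i j *t sig j) | i <- index_enum 'I_3].

Lemma of_co2_EE t : EE (of_co2 t).
Proof.
by move=> q /mapP[i _ ->]; split; [exact: Omega1_frame | exact: Omega1_sum_sig].
Qed.

Lemma co2_of_co2 i j t : co2 i j (of_co2 t) = t i j.
Proof.
rewrite !co2E big_map (bigD1 i) //= co_frame eqxx mul1mx co_sum_sig.
rewrite big1 ?addr0 // => k /negPf ki.
by rewrite co_frame eq_sym ki raddf0 mul0mx.
Qed.

(** Lists are compared through [tval], so [co2] has to factor through the Kronecker product, as it
    does by bilinearity. *)
Lemma co2_tval_eq0 i j (r : seq (BH * BH)) (W : 'M[C]_(Hdim N * Hdim N)) :
  W = \sum_(q <- r) q.1 *t q.2 -> W = 0 -> co2 i j r = 0.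
Proof.
(* The linear extension of u (x) v |-> co i u co j v: the second factor is expanded in matrix units,
   and a partial trace recovers the matching first factor. *)
pose F (V : 'M[C]_(Hdim N * Hdim N)) : AN :=
  \sum_a \sum_b co i (ptr (delta_mx b a) V) *m co j (delta_mx a b).
have FD u v : F (u + v) = F u + F v.
  rewrite -big_split; apply: eq_bigr => a _; rewrite -big_split; apply: eq_bigr => b _.
  by rewrite /= !raddfD mulmxDl.
have F0 : F 0 = 0.
  by rewrite /F big1 // => a _; rewrite big1 // => b _; rewrite !raddf0 mul0mx.
have FE u v : F (u *t v) = co i u *m co j v.
  rewrite [v in RHS]matrix_sum_delta raddf_sum mulmx_sumr; apply: eq_bigr => a _.
  rewrite raddf_sum mulmx_sumr; apply: eq_bigr => b _ /=.
  rewrite ptr_tens [co i _]linearZ [in RHS]linearZ /= -scalemxAl -scalemxAr; congr (_ *: _).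
  rewrite /mxtrace (bigD1 a) //= big1 ?addr0 => [|c /negPf ca].
    rewrite mxE (bigD1 b) //= big1 ?addr0 => [|c /negPf cb]; last first.
      by rewrite [delta_mx _ _ _ _]mxE cb mulr0.
    by rewrite mxE !eqxx mulr1.
  by rewrite mxE big1 // => e _; rewrite [delta_mx _ _ _ _]mxE ca andbF mulr0.
move=> rE W0; rewrite co2E -[RHS]F0 -W0 rE (big_morph F FD F0).
by apply: eq_bigr => q _; rewrite FE.
Qed.

(** Balancing relations have coordinate 0 because co i (w a) co j e = co i w co j (a e). All terms
    are gathered with their signs in one list [r'] whose tensor sum is zero. *)
Lemma co2_teq i j s s' : teq rho s s' -> co2 i j s = co2 i j s'.
Proof.
case=> r [_ E]; apply/eqP; rewrite -subr_eq0; apply/eqP.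
pose r' : seq (BH * BH) := s ++ tscale (-1) s'
  ++ tscale (-1) [seq (q.1.1 *m piA q.1.2, q.2) | q <- r]
  ++ [seq (q.1.1, piA q.1.2 *m q.2) | q <- r].
have rE : co2 i j r' = co2 i j s - co2 i j s'.
  rewrite /r' !co2_cat !co2_scale !scaleN1r !co2E !big_map addrA.
  rewrite [X in - _ + X](_ : _ = \sum_(q <- r) co i (q.1.1 *m piA q.1.2) *m co j q.2).
    by rewrite addNr addr0.
  by apply: eq_bigr => q _; rewrite /= co_mulr co_mull mulmxA.
rewrite -rE; apply: co2_tval_eq0 (erefl _) _.
have sumN (t : seq (BH * BH)) : \sum_(q <- tscale (-1) t) q.1 *t q.2
    = - \sum_(q <- t) q.1 *t q.2 :> 'M[C]_(Hdim N * Hdim N).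
  rewrite big_map -sumrN; apply: eq_bigr => q _ /=.
  by rewrite tensmxZl scaleN1r.
rewrite !big_cat /= !sumN !big_map /= addrA -/(Defs.tval s) -/(Defs.tval s') E.
by rewrite sumrB [- _ + _]addrC -opprB addNr.
Qed.

(** Writing w = sum_i frame_i a_i and moving each a_i across brings w (x) e to the normal form [nf],
    which depends on the coordinates alone. The list [bs c] records these balancing relations with
    weight c; weights 1 and -1 lead from s to s' through the common normal form. *)
Lemma teq_co2 s s' : EE s -> EE s' ->
  (forall i j, co2 i j s = co2 i j s') -> teq rho s s'.
Proof.
move=> sE s'E ss'.
pose nf s := \sum_i \sum_j frame N i *t (co2 i j s *t sig j).
pose bal (r : seq (BH * AN * BH)) := \sum_(q <- r)
  ((q.1.1 *m piA q.1.2) *t q.2 - q.1.1 *t (piA q.1.2 *m q.2)).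
pose bs (c : C) s := [seq (c *: frame N i, co i q.1, q.2)
  | q <- s, i <- index_enum 'I_3] : seq (BH * AN * BH).
have coE (a : AN) i : frame N i *m piA a = a *t sig i.
  by rewrite /frame /piA tensmx_mul mul1mx mulmx1.
have balE c t : EE t -> bal (bs c t) = c *: (Defs.tval t - nf t).
  move=> tE; rewrite /bal /bs big_allpairs_dep /nf.
  have -> : \sum_i \sum_j frame N i *t (co2 i j t *t sig j)
      = \sum_(q <- t) \sum_i frame N i *t (piA (co i q.1) *m q.2).
    rewrite [RHS]exchange_big; apply: eq_bigr => i _ /=.
    rewrite -!tensmx_sumr; congr (_ *t _).
    under eq_bigr do rewrite co2E tensmx_suml.
    rewrite exchange_big big_seq [RHS]big_seq; apply: eq_bigr => q /tE[_ /Omega1_decomp E].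
    rewrite [in RHS]E mulmx_sumr; apply: eq_bigr => j _.
    by rewrite /piA tensmx_mul mul1mx.
  rewrite -sumrB scaler_sumr big_seq [RHS]big_seq; apply: eq_bigr => q /tE[/Omega1_decomp E _].
  rewrite sumrB /= scalerBr; congr (_ - _); last first.
    by rewrite scaler_sumr; apply: eq_bigr => i _; rewrite tensmxZl.
  rewrite [in RHS]E tensmx_suml scaler_sumr; apply: eq_bigr => i _.
  by rewrite -scalemxAl coE tensmxZl.
exists (bs 1 s ++ bs (-1) s'); split=> [q|].
  rewrite mem_cat => /orP[] /allpairsP[[p i] [/= pin _ ->]] /=;
    (split; first exact/Omega1Z/Omega1_frame).
    by case: (sE _ pin).
  by case: (s'E _ pin).
rewrite big_cat /= -/(bal (bs 1 s)) -/(bal (bs (-1) s')) !balE // scale1r scaleN1r.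
have -> : nf s' = nf s.
  by apply: eq_bigr => i _; apply: eq_bigr => j _; rewrite ss'.
by rewrite opprB addrA subrK.
Qed.

End TensorSquare.

(** * Commutator identities, the exterior derivative and J^2 *)

Section NoncommutativeIdentities.
Variable n : nat.
Implicit Types a b Y Z : 'M[C]_n.

Lemma commx_mul Z a b : commx Z (a *m b) = commx Z a *m b + a *m commx Z b.
Proof.
by rewrite /commx mulmxBl mulmxBr !mulmxA addrA subrK.
Qed.

Lemma commx_jacobi Y Z b :
  commx Y (commx Z b) - commx Z (commx Y b) = commx (commx Y Z) b.
Proof.
rewrite /commx !mulmxBl !mulmxBr !mulmxA.
move: (Y *m Z *m b) (Y *m b *m Z) (Z *m b *m Y) (b *m Z *m Y) (Z *m Y *m b)
  (b *m Y *m Z) => m1 m2 m3 m4 m5 m6.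
by apply/matrixP => i j; rewrite !mxE; ring.
Qed.

Lemma commx_suml (I : finType) (c : I -> C) (Z : I -> 'M[C]_n) b :
  commx (\sum_i c i *: Z i) b = \sum_i c i *: commx (Z i) b.
Proof.
rewrite /commx mulmx_suml mulmx_sumr -sumrB; apply: eq_bigr => i _.
by rewrite -scalemxAl -scalemxAr scalerBr.
Qed.

Lemma commx_sumr I (r : seq I) Z (F : I -> 'M[C]_n) :
  commx Z (\sum_(i <- r) F i) = \sum_(i <- r) commx Z (F i).
Proof. by rewrite /commx mulmx_suml mulmx_sumr -sumrB. Qed.

End NoncommutativeIdentities.

Lemma eps_contract k m :
  \sum_i \sum_j eps i j k * eps i j m = (k == m)%:R *+ 2.
Proof.
by rewrite !sum_ord3 !epsE; move: k m; do 2 ![apply: ord3_ind];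
  rewrite /= !(expr0, exprS); ring.
Qed.

Section ExteriorDerivative.
Variables (N : nat) (rho : forall n : 'I_N.+1, 'I_3 -> 'M[C]_n.+1).
Hypothesis N_gt0 : (1 <= N)%N.
Hypothesis rhoP : forall n : 'I_N.+1, su2_irrep (rho n).
Local Notation X := (Xop rho).
Local Notation AN := 'M[C]_(Kdim N).
Local Notation BH := 'M[C]_(Hdim N).
Local Notation J2 := (inJ2 rho).
Local Notation d := (dD rho).
Local Notation EE := (inEE rho).

Lemma co_wedge k s : EE s -> co k (wedge s) = - \sum_i \sum_j eps i j k *: co2 i j s.
Proof.
move=> sE; rewrite /wedge raddf_sum.
transitivity (\sum_(q <- s) - \sum_i \sum_j eps i j k *: (co i q.1 *m co j q.2)).
  rewrite big_seq [RHS]big_seq; apply: eq_bigr => q /sE[q1 q2] /=.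
  by rewrite (co_mul N_gt0 rhoP).
rewrite sumrN exchange_big; congr (- _); apply: eq_bigr => i _ /=.
by rewrite exchange_big; apply: eq_bigr => j _; rewrite co2E scaler_sumr.
Qed.

Definition d_tens (s : seq (AN * AN)) : seq (BH * BH) :=
  [seq (d (piA q.1), d (piA q.2)) | q <- s].

Lemma d_tens_EE s : EE (d_tens s).
Proof. by move=> q /mapP[r _ ->]; split; exact: Omega1_d. Qed.

Lemma wedge_d_tens s : wedge (d_tens s) = \sum_(q <- s) d (piA q.1) *m d (piA q.2).
Proof. by rewrite /wedge big_map. Qed.

Lemma co_form l (s : seq (AN * AN)) :
  co l (\sum_(q <- s) piA q.1 *m d (piA q.2)) = \sum_(q <- s) q.1 *m commx (X l) q.2.
Proof. by rewrite raddf_sum; apply: eq_bigr => q _; rewrite /= co_mull co_dD. Qed.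

(* Moving the derivation X p off the left factor; the double commutators
   antisymmetrise, by the Jacobi identity, to a first-order term. *)
Lemma d_tens_antisym (s : seq (AN * AN)) p l :
  let w := \sum_(q <- s) piA q.1 *m d (piA q.2) in
  co2 p l (d_tens s) - co2 l p (d_tens s) =
    commx (X p) (co l w) - commx (X l) (co p w) - \sum_m eps p l m *: co m w.
Proof.
move=> w.
have co2_d i j : co2 i j (d_tens s) = commx (X i) (co j w)
    - \sum_(q <- s) q.1 *m commx (X i) (commx (X j) q.2).
  rewrite co2E big_map co_form commx_sumr -sumrB; apply: eq_bigr => q _ /=.
  by rewrite !co_dD commx_mul addrK.
have jac : \sum_(q <- s) q.1 *m commx (X p) (commx (X l) q.2)
   - \sum_(q <- s) q.1 *m commx (X l) (commx (X p) q.2) = \sum_m eps p l m *: co m w.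
  under [RHS]eq_bigr do rewrite co_form scaler_sumr.
  rewrite exchange_big -sumrB; apply: eq_bigr => q _ /=.
  rewrite -mulmxBr commx_jacobi (Xop_comm rhoP p l : commx (X p) (X l) = _) commx_suml.
  by rewrite mulmx_sumr; apply: eq_bigr => m _; rewrite scalemxAr.
have subACA (a b e f : AN) : (a - b) - (e - f) = (a - e) - (b - f).
  by rewrite !opprB addrACA [RHS]addrACA [- b + _]addrC.
by rewrite !co2_d -jac subACA.
Qed.

(** If sum a db = 0, then [d_tens_antisym] makes the coordinates of sum da (x) db symmetric, so the
    product keeps only its component along 1. Conversely, that component can be prescribed at will
    by means of the functional of [Casimir_dual]. *)
Lemma J2E w : J2 w <-> forall k, co k w = 0.
Proof.
split=> [[s [s0 ->]] k|w0].
  rewrite -wedge_d_tens co_wedge; last exact: d_tens_EE.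
  apply/eqP; rewrite oppr_eq0; apply/eqP; move: k; apply/eps_sum_eq0 => i j.
  apply/eqP; rewrite -subr_eq0 d_tens_antisym s0 !raddf0 /commx.
  rewrite !mulmx0 !mul0mx !subrr sub0r oppr_eq0 big1 // => m _.
  by rewrite raddf0 scaler0.
have [L [trL LX Lcas]] := Casimir_dual N_gt0 rhoP; have [s sP] := dual_seq L.
(* Left multiplication by c preserves sum a [X_j, b] = 0 and scales the second-order sum, which
   [Lcas] normalises to 1, to c. *)
pose c := co0 w; pose s' := [seq (c *m q.1, q.2) | q <- s].
have sum0 j : \sum_(q <- s') q.1 *m commx (X j) q.2 = 0.
  rewrite big_map; under eq_bigr do rewrite /= -mulmxA.
  by rewrite -mulmx_sumr (sum_commutator _ sP trL) LX raddf0 mulmx0.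
have form0 : \sum_(q <- s') piA q.1 *m d (piA q.2) = 0.
  apply: eq_coP => [|j]; last by rewrite co_form sum0 raddf0.
  by rewrite !raddf0 raddf_sum big1 // => q _; rewrite /= co0_mull co0_dD mulmx0.
exists s'; split=> //; apply: eq_coP => [|k]; last first.
  rewrite w0 -wedge_d_tens co_wedge; last exact: d_tens_EE.
  apply/esym/eqP; rewrite oppr_eq0; apply/eqP; move: k; apply/eps_sum_eq0 => i j.
  apply/eqP; rewrite -subr_eq0 d_tens_antisym form0 !raddf0 /commx.
  rewrite !mulmx0 !mul0mx !subrr sub0r oppr_eq0 big1 // => m _.
  by rewrite raddf0 scaler0.
rewrite raddf_sum -/c; apply/esym.
transitivity (- \sum_(q <- s') \sum_i commx (X i) q.1 *m commx (X i) q.2).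
  rewrite -sumrN; apply: eq_bigr => q _ /=.
  rewrite (co0_mul N_gt0 rhoP); try exact: Omega1_d.
  congr (- _); apply: eq_bigr => i _.
  by congr (_ *m _); exact: co_dD.
(* Applying the derivation [X_i, .] to sum a [X_i, b] = 0 trades - sum [X_i, a] [X_i, b] for sum a
   [X_i, [X_i, b]]. *)
transitivity (\sum_i \sum_(q <- s') q.1 *m commx (X i) (commx (X i) q.2)).
  rewrite exchange_big -sumrN; apply: eq_bigr => i _ /=.
  have /eqP : \sum_(q <- s') (commx (X i) q.1 *m commx (X i) q.2
      + q.1 *m commx (X i) (commx (X i) q.2)) = 0.
    transitivity (commx (X i) (\sum_(q <- s') q.1 *m commx (X i) q.2)).
      by rewrite commx_sumr; apply: eq_bigr => q _; rewrite commx_mul.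
    by rewrite sum0 /commx mulmx0 mul0mx subrr.
  by rewrite big_split /= addrC addr_eq0 => /eqP ->.
(* Of the double commutator only a X_i X_i b survives: the other terms contain a sandwich of X_i or
   of 1, and both traces against L vanish. *)
have sum2 i : \sum_(q <- s) q.1 *m commx (X i) (commx (X i) q.2)
    = (\tr (L *m (X i *m X i)))%:M.
  have comE : \sum_(q <- s) q.1 *m (X i) *m commx (X i) q.2 = (\tr (L *m (X i *m X i)))%:M.
    under eq_bigr => q _ do rewrite mulmxBr !mulmxA -(mulmxA q.1 (X i) (X i)).
    by rewrite sumrB sP -mulmx_suml sP LX raddf0 mul0mx subr0.
  under eq_bigr do rewrite {1}/commx mulmxBr !mulmxA.
  by rewrite sumrB -mulmx_suml (sum_commutator _ sP trL) LX raddf0 mul0mx subr0 comE.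
transitivity (c *m (\tr (L *m \sum_k X k *m X k))%:M); last by rewrite Lcas mulmx1.
have -> : (\tr (L *m \sum_k X k *m X k))%:M
    = \sum_k (\tr (L *m (X k *m X k)))%:M :> AN.
  by rewrite mulmx_sumr (raddf_sum (@mxtrace _ _)) raddf_sum.
rewrite mulmx_sumr; apply: eq_bigr => i _ /=.
rewrite -sum2 mulmx_sumr big_map; apply: eq_bigr => q _ /=.
by rewrite mulmxA.
Qed.

End ExteriorDerivative.

(** * Central forms, the splitting of E (x) E and the flip *)

Section Splitting.
Variables (N : nat) (rho : forall n : 'I_N.+1, 'I_3 -> 'M[C]_n.+1).
Hypothesis N_gt0 : (1 <= N)%N.
Hypothesis rhoP : forall n : 'I_N.+1, su2_irrep (rho n).
Local Notation AN := 'M[C]_(Kdim N).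
Local Notation BH := 'M[C]_(Hdim N).
Local Notation EE := (inEE rho).
Local Notation ZE := (inZE rho).

Fact Kdim_gt0 : (0 < Kdim N)%N.
Proof. by rewrite /Kdim big_ord_recl. Qed.

Definition Kord : 'I_(Kdim N) := Ordinal Kdim_gt0.

Lemma scalar_mx_inj (a b : C) : a%:M = b%:M :> AN -> a = b.
Proof. by move/matrixP/(_ Kord Kord); rewrite !mxE eqxx. Qed.

Lemma central_scalar (z : AN) : (forall b, b *m z = z *m b) -> exists c : C, z = c%:M.
Proof.
move=> zC; set o := Kord; exists (z o o).
apply/matrixP => j k; have /matrixP/(_ o k) := zC (delta_mx o j).
rewrite !mxE (bigD1 j) //= big1 => [|l /negPf lj]; last first.
  by rewrite mxE lj andbF mul0r.
rewrite mxE !eqxx mul1r addr0 => ->; rewrite (bigD1 o) //= big1 => [|l /negPf lo].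
  by rewrite mxE eqxx andTb addr0 mulr_natr eq_sym.
by rewrite mxE lo mulr0.
Qed.

(** Being a bimodule map, [co k] sends central forms into the centre of A_N, which consists of
    scalars. *)
Lemma ZE_scalar w k : ZE w -> exists c : C, co k w = c%:M.
Proof.
case=> _ wC; apply: central_scalar => b.
by rewrite -co_mull wC co_mulr.
Qed.

Lemma ZE_frame k : ZE (frame N k).
Proof.
split=> [|a]; first exact: Omega1_frame.
by rewrite /piA /frame !tensmx_mul !mul1mx !mulmx1.
Qed.

Lemma frame_mul a k : frame N k *m piA a = a *t sig k.
Proof. by rewrite /frame /piA tensmx_mul mul1mx mulmx1. Qed.

Lemma frame_mult_iso : mult_iso rho.
Proof.
split=> [w wO|s s' sZ s'Z E].
  exists [seq (frame N k, co k w) | k <- index_enum 'I_3]; split=> [q /mapP[k _ ->]|].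
    exact: ZE_frame.
  rewrite /multZ big_map [RHS](Omega1_decomp N_gt0 rhoP wO); apply: eq_bigr => k _.
  exact: frame_mul.
(* The empty list of relations works: coordinates of central forms are scalars and cross the complex
   tensor product, so [multZ t] already determines [tvalZ t]. *)
exists [::]; split=> [//|]; rewrite big_nil; apply/eqP; rewrite subr_eq0; apply/eqP.
suff tvalE t : inZEA rho t ->
    tvalZ t = \sum_k (frame N k *t co k (multZ t) : 'M[C]_(Hdim N * Kdim N)).
  by rewrite !tvalE // E.
move=> tZ; rewrite /tvalZ /multZ.
under [RHS]eq_bigr do rewrite raddf_sum tensmx_sumr.
rewrite exchange_big big_seq [RHS]big_seq; apply: eq_bigr => q /tZ qZ /=.
rewrite {1}(Omega1_decomp N_gt0 rhoP qZ.1) tensmx_suml; apply: eq_bigr => k _.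
rewrite co_mulr; have [c ->] := ZE_scalar k qZ.
by rewrite mul_scalar_mx tensmxZr -tensmxZl -scalemx1 tensmxZl [LHS]tensmxZl -tensmxZl.
Qed.

Definition antisym (s : seq (BH * BH)) : Prop :=
  EE s /\ forall i j, co2 i j s = - co2 j i s.

Lemma kerWedgeE s : inKerWedge rho s <-> EE s /\ forall i j, co2 i j s = co2 j i s.
Proof.
suff wedgeE : EE s ->
    (forall k, co k (wedge s) = 0) <-> (forall i j, co2 i j s = co2 j i s).
  have J2W := J2E N_gt0 rhoP (wedge s).
  by split=> -[sE sP]; have sW := wedgeE sE; split; [|exact/sW/J2W| |exact/J2W/sW].
move=> sE; apply: iff_trans (eps_sum_eq0 _); split=> H k; apply/eqP.
  by rewrite -oppr_eq0 -(co_wedge N_gt0 rhoP) // H.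
by rewrite (co_wedge N_gt0 rhoP) // oppr_eq0 H.
Qed.

Lemma sym_antisym_eq0 (t : 'I_3 -> 'I_3 -> AN) :
  (forall i j, t i j = t j i) -> (forall i j, t i j = - t j i) -> forall i j, t i j = 0.
Proof.
move=> tS tA i j; have /eqP := tA i j; rewrite tS -addr_eq0 -mulr2n -scaler_nat.
by rewrite scaler_eq0 pnatr_eq0 => /eqP.
Qed.

Let teqE s s' := @teq_co2 N rho N_gt0 rhoP s s'.

Lemma antisym_submodule : right_submodule rho antisym.
Proof.
split; first by move=> s [].
split=> [s s' s'E E [_ sA]|].
  by split=> // i j; rewrite -!(co2_teq _ _ E).
split; first by split=> [q|i j]; rewrite ?in_nil // !co2_nil oppr0.
split=> [s s' [sE sA] [s'E s'A]|].
  split=> [|i j]; first exact: EE_cat.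
  by rewrite !co2_cat sA s'A opprD.
split=> [c s [sE sA]|s a [sE sA]].
  split=> [|i j]; first exact: EE_scale.
  by rewrite !co2_scale sA scalerN.
split=> [|i j]; first exact: EE_ract.
by rewrite !co2_ract sA mulNmx.
Qed.

Lemma antisym_direct : direct_sum_ker rho antisym.
Proof.
split=> [s sE|s /kerWedgeE[sE sS] [_ sA]]; last first.
  apply: teqE => [||i j]; [exact: sE | exact: EE_nil | rewrite co2_nil].
  exact: (sym_antisym_eq0 (t := fun i j => co2 i j s)).
pose half c := of_co2 (fun i j => 2%:R^-1 *: (co2 i j s + c *: co2 j i s)).
exists (half 1), (half (-1)); split; last split.
- apply/kerWedgeE; split=> [|i j]; first exact: of_co2_EE.
  by rewrite !co2_of_co2 !scale1r addrC.
- split=> [|i j]; first exact: of_co2_EE.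
  by rewrite !co2_of_co2 !scaleN1r -scalerN opprB.
apply: teqE => // [|i j]; first by apply: EE_cat; exact: of_co2_EE.
have half_sum (a b : AN) :
    a = 2%:R^-1 *: (a + 1 *: b) + 2%:R^-1 *: (a + (-1) *: b).
  by apply/matrixP => x y; rewrite !mxE; field.
by rewrite co2_cat !co2_of_co2 -half_sum.
Qed.

Lemma antisym_wedge_iso : wedge_F_iso rho antisym.
Proof.
split=> [f f' [fE fA] [f'E f'A] /(J2E N_gt0 rhoP) ff'|x _].
  apply: teqE => // i j; apply/eqP; rewrite -subr_eq0; apply/eqP; move: i j.
  apply: sym_antisym_eq0 => [|i j]; last by rewrite fA f'A opprB opprK addrC.
  apply/eps_sum_eq0 => k; have /eqP := ff' k.
  rewrite raddfB /= !(co_wedge N_gt0 rhoP) // -opprD oppr_eq0 => /eqP E0.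
  apply: etrans E0; rewrite -sumrB; apply: eq_bigr => i _.
  rewrite -sumrB; apply: eq_bigr => j _.
  by rewrite scalerBr.
(* The factor -1/2 compensates the sign in [co_wedge] and the 2 in [eps_contract]. *)
exists (of_co2 (fun i j => - 2%:R^-1 *: \sum_m eps i j m *: co m x)).
split.
  split=> [|i j]; first exact: of_co2_EE.
  rewrite !co2_of_co2 -scalerN -sumrN; congr (_ *: _); apply: eq_bigr => m _.
  by rewrite eps_swap scaleNr.
apply/(J2E N_gt0 rhoP) => k; rewrite raddfB /=.
rewrite (co_wedge N_gt0 rhoP); last exact: of_co2_EE.
apply/eqP; rewrite subr_eq0; apply/eqP.
transitivity (2%:R^-1 *: \sum_m (\sum_i \sum_j eps i j k * eps i j m) *: co m x).
  rewrite scaler_sumr -sumrN.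
  under [RHS]eq_bigr do rewrite scaler_suml scaler_sumr.
  rewrite [RHS]exchange_big; apply: eq_bigr => i _ /=.
  rewrite -sumrN; under [RHS]eq_bigr do rewrite scaler_suml scaler_sumr.
  rewrite [RHS]exchange_big; apply: eq_bigr => j _ /=.
  rewrite co2_of_co2 scaleNr scalerN opprK !scaler_sumr; apply: eq_bigr => m _.
  by rewrite !scalerA; congr (_ *: _); ring.
under eq_bigr do rewrite eps_contract.
rewrite (bigD1 k) //= eqxx big1 ?addr0 => [|m /negPf km]; last first.
  by rewrite eq_sym km mul0rn scale0r.
by rewrite scalerA mulVf ?scale1r // pnatr_eq0.
Qed.

(** Exchanging the indices fixes symmetric tensors and negates antisymmetric ones, as 2 P_sym - 1
    does. *)
Lemma co2_sigma sigma s i j : is_sigma rho antisym sigma -> EE s ->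
  co2 i j (sigma s) = co2 j i s.
Proof.
move=> sigmaP sE; have [_ [k [f [/kerWedgeE[_ kS] [[_ fA] [E1 E2]]]]]] := sigmaP s sE.
rewrite (co2_teq i j E2) (co2_teq j i E1) !co2_cat co2_scale kS (fA i j).
by rewrite scaleN1r opprK.
Qed.

(** The exchange of indices yields co j w co i e, with the factors in the order opposite to that of
    e (x) w; for central forms they are scalars and commute. *)
Lemma sigma_flip sigma w e : is_sigma rho antisym sigma -> ZE w -> ZE e ->
  teq rho (sigma [:: (w, e)]) [:: (e, w)].
Proof.
move=> sigmaP wZ eZ.
have weE : EE [:: (w, e)] by apply: EE_seq1; [case: wZ | case: eZ].
apply: teqE => [||i j]; first by case: (sigmaP _ weE).
  by apply: EE_seq1; [case: eZ | case: wZ].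
rewrite co2_sigma // !co2_seq1; have [c ->] := ZE_scalar j wZ.
by rewrite mul_scalar_mx mul_mx_scalar.
Qed.

End Splitting.

(** * The linear algebra of the Koszul formula *)

Section Koszul.

(** The two sides of the braid relation in S_3 give the same reordering of the indices with opposite
    signs, so b = - b. *)
Lemma sym_antisym3_eq0 (I : Type) (b : I -> I -> I -> C) :
  (forall k l m, b k l m = b k m l) -> (forall k l m, b k l m = - b l k m) ->
  forall k l m, b k l m = 0.
Proof.
move=> bS bA k l m; apply/eqP; have /eqP : b k l m = - b k l m.
  by rewrite {1}bS bA bS bA opprK bS bA.
by rewrite -addr_eq0 -mulr2n mulrn_eq0.
Qed.

(* The Koszul formula, for a prescribed torsion t. *)
Lemma koszul_tensor (I : Type) (t : I -> I -> I -> C) :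
  (forall k l m, t k l m = - t k m l) ->
  exists a : I -> I -> I -> C,
    (forall k l m, a k l m - a k m l = t k l m) /\
    (forall k l m, a k l m + a l k m = 0).
Proof.
move=> tA; exists (fun k l m => 2%:R^-1 * (t k l m - t m k l + t l m k)).
split=> k l m; first by rewrite (tA k m l) (tA l k m) (tA m l k); field.
by rewrite (tA m l k) (tA k m l) (tA l k m) (tA l m k); field.
Qed.

Variables (n : nat) (G : 'M[C]_n).
Hypotheses (G_unit : G \in unitmx) (G_sym : G^T = G).

(** Multiplication by G on the right lowers the remaining index: (G D_k G)_lp is symmetric in (l, p)
    and antisymmetric in (k, l). *)
Lemma koszul_unique (D : 'I_n -> 'M[C]_n) :
  (forall k, (D k)^T = D k) ->
  (forall k l m, (G *m D k) l m = - (G *m D l) k m) -> forall k, D k = 0.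
Proof.
move=> DS DA k.
have B0 : G *m D k *m G = 0.
  apply/matrixP => l p; rewrite [RHS]mxE.
  apply: (@sym_antisym3_eq0 _ (fun k l p => (G *m D k *m G) l p)) => {k l p} k l p.
    have BT : (G *m D k *m G)^T = G *m D k *m G.
      by rewrite !trmx_mul G_sym DS mulmxA.
    by rewrite -{1}BT mxE.
  rewrite mxE [in RHS]mxE -sumrN; apply: eq_bigr => m _.
  by rewrite DA mulNr.
by rewrite -[D k](mulKmx G_unit) -[_ *m D k](mulmxK G_unit) B0 mul0mx mulmx0.
Qed.

(** [koszul_tensor] solves the problem with all indices lowered, for the torsion G E_k G; [invmx G]
    on both sides raises two of them again. *)
Lemma koszul_exists (E : 'I_n -> 'M[C]_n) :
  (forall k, (E k)^T = - E k) ->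
  exists Gam : 'I_n -> 'M[C]_n,
    (forall k, Gam k - (Gam k)^T = E k) /\
    (forall k l m, (G *m Gam k) l m + (G *m Gam l) k m = 0).
Proof.
move=> EA.
have TA k l m : (G *m E k *m G) l m = - (G *m E k *m G) m l.
  have TT : (G *m E k *m G)^T = - (G *m E k *m G).
    by rewrite !trmx_mul G_sym EA mulNmx mulmxN mulmxA.
  by rewrite -[in LHS](opprK (G *m E k *m G)) -TT mxE mxE.
have [a [aT aA]] := @koszul_tensor _ (fun k l m => (G *m E k *m G) l m) TA.
exists (fun k => invmx G *m (\matrix_(l, m) a k l m) *m invmx G).
split=> [k|k l m].
  have AT : (\matrix_(l, m) a k l m) - (\matrix_(l, m) a k l m)^T = G *m E k *m G.
    apply/matrixP => l m; transitivity (a k l m - a k m l); last exact: aT.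
    by rewrite !mxE.
  rewrite !trmx_mul trmx_inv G_sym mulmxA -mulmxBl -mulmxBr AT.
  by rewrite -[G *m E k *m G]mulmxA mulKmx // mulmxK.
have cancelG (H : 'M[C]_n) i :
    (G *m (invmx G *m H *m invmx G)) i m = \sum_p H i p * invmx G p m.
  by rewrite !mulmxA mulmxV // mul1mx mxE.
apply: etrans (congr2 +%R (cancelG _ _) (cancelG _ _)) _.
rewrite -big_split big1 // => p _ /=.
by rewrite -mulrDl 2![(\matrix_(_, _) _) _ _]mxE aA mul0r.
Qed.

End Koszul.

(** * Torsion, compatibility and the Levi-Civita connection *)

Section LeviCivita.
Variables (N : nat) (rho : forall n : 'I_N.+1, 'I_3 -> 'M[C]_n.+1).
Hypothesis N_gt0 : (1 <= N)%N.
Hypothesis rhoP : forall n : 'I_N.+1, su2_irrep (rho n).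
Local Notation X := (Xop rho).
Local Notation AN := 'M[C]_(Kdim N).
Local Notation BH := 'M[C]_(Hdim N).
Local Notation Omega1 := (inOmega1 rho).
Local Notation d := (dD rho).
Local Notation EE := (inEE rho).
Local Notation ZE := (inZE rho).
Local Notation e_ := (frame N).

Let e_in k : Omega1 (e_ k) := Omega1_frame N_gt0 rhoP k.
Let teqE s s' := @teq_co2 N rho N_gt0 rhoP s s'.

(** For w = sum a db the condition says that [nab w ++ d_tens s] has symmetric coordinates. By
    [d_tens_antisym] the antisymmetric part of [d_tens s] depends on w alone, which eliminates the
    presentation s. *)
Lemma torsionlessP nab : (forall w, Omega1 w -> EE (nab w)) ->
  torsionless rho nab <-> forall w, Omega1 w -> forall p l,
    co2 p l (nab w) - co2 l p (nab w) =
    - (commx (X p) (co l w) - commx (X l) (co p w) - \sum_m eps p l m *: co m w).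
Proof.
move=> nabE; split=> [tor w [s wE] p l|tor s].
  have wO : Omega1 w by exists s.
  have := tor s; rewrite -wE -wedge_d_tens /wedge -big_cat => J2w.
  have /(kerWedgeE N_gt0 rhoP)[_ /(_ p l)] : inKerWedge rho (nab w ++ d_tens rho s).
    by split=> //; apply: EE_cat; [exact: nabE | exact: d_tens_EE].
  have := d_tens_antisym rhoP s p l; rewrite /= -wE => <- /eqP.
  by rewrite !co2_cat -subr_eq0 opprD addrACA addr_eq0 => /eqP.
have wO : Omega1 (\sum_(q <- s) piA q.1 *m d (piA q.2)) by exists s.
rewrite -wedge_d_tens /wedge -big_cat.
suff [] : inKerWedge rho (nab (\sum_(q <- s) piA q.1 *m d (piA q.2)) ++ d_tens rho s) by [].
apply/(kerWedgeE N_gt0 rhoP); split=> [|p l].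
  by apply: EE_cat; [exact: nabE | exact: d_tens_EE].
apply/eqP; rewrite !co2_cat -subr_eq0 opprD addrACA tor //.
by rewrite (d_tens_antisym rhoP s p l) addNr.
Qed.

(** The Leibniz rule applied to w = sum_k frame_k (co k w): the values on the frame determine the
    connection. *)
Lemma connection_co2 nab w i j : connection rho nab -> Omega1 w ->
  co2 i j (nab w) = \sum_k (co2 i j (nab (e_ k)) *m co k w
                            + co i (e_ k) *m co j (d (piA (co k w)))).
Proof.
move=> [nabE nabD _ nabM] wO; rewrite sum_ord3.
have nabe k : co2 i j (nab (e_ k *m piA (co k w))) = co2 i j (nab (e_ k)) *m co k w
    + co i (e_ k) *m co j (d (piA (co k w))).
  by rewrite (co2_teq i j (nabM _ _ (e_in k))) co2_cat co2_ract co2_seq1.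
have eO k : Omega1 (e_ k *m piA (co k w)) by exact: Omega1_mulr.
rewrite -(nabe k1) -(nabe k2) -(nabe k3).
have wE : w = e_ k1 *m piA (co k1 w) + e_ k2 *m piA (co k2 w) + e_ k3 *m piA (co k3 w).
  by rewrite [LHS](Omega1_decomp N_gt0 rhoP wO) sum_ord3 -3!frame_mul.
have e12O := Omega1D N_gt0 rhoP (eO k1) (eO k2).
rewrite {1}wE (co2_teq i j (nabD _ _ e12O (eO k3))) !co2_cat.
by rewrite (co2_teq i j (nabD _ _ (eO k1) (eO k2))) co2_cat.
Qed.

Section Metric.
Variables (sigma : seq (BH * BH) -> seq (BH * BH)) (g0 : BH -> BH -> AN).
Hypothesis sigmaP : is_sigma rho (@antisym N rho) sigma.
Hypothesis gP : pR_metric rho sigma g0.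

Lemma metric_matrix : exists G : 'M[C]_3, [/\ G \in unitmx, G^T = G &
  forall u v, Omega1 u -> Omega1 v ->
    g0 u v = \sum_i \sum_j G i j *: (co i u *m co j v)].
Proof.
case: gP => gT gL gS gI _.
(* Centrality of the frame and balancing give b g(e_i, e_j) = g(e_i b, e_j) = g(e_i, b e_j) = g(e_i,
   e_j) b. *)
have gC i j : exists c : C, g0 (e_ i) (e_ j) = c%:M.
  apply: central_scalar => b.
  have comm k : piA b *m e_ k = e_ k *m piA b by have [_ ->] := ZE_frame N_gt0 rhoP k.
  rewrite -(gL b _ _ (e_in i) (e_in j)).1 -(gL b _ _ (e_in i) (e_in j)).2 -(comm j) comm.
  have eiO : Omega1 (e_ i *m piA b) by exact: Omega1_mulr.
  have ejO : Omega1 (piA b *m e_ j) by exact: Omega1_mull.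
  have E1 := EE_seq1 eiO (e_in j); have E2 := EE_seq1 (e_in i) ejO.
  have := gT _ _ E1 E2; rewrite /gext !big_seq1; apply.
  by apply: teqE => // i' j'; rewrite !co2_seq1 co_mulr co_mull mulmxA.
have [G0 G0E] := fin_all_exists (fun i => fin_all_exists (gC i)).
pose G : 'M[C]_3 := \matrix_(i, j) G0 i j.
have GE i j : g0 (e_ i) (e_ j) = (G i j)%:M by rewrite G0E mxE.
have gE u v : Omega1 u -> Omega1 v ->
    g0 u v = \sum_i \sum_j G i j *: (co i u *m co j v).
  move=> uO vO.
  pose s' := [seq (piA (co i u) *m e_ i, e_ j *m piA (co j v))
    | i <- index_enum 'I_3, j <- index_enum 'I_3].
  have aeO a i : Omega1 (piA a *m e_ i) by exact: Omega1_mull.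
  have eaO a i : Omega1 (e_ i *m piA a) by exact: Omega1_mulr.
  have s'E : EE s' by move=> q /allpairsP[[i j] [_ _ ->]]; split; [exact: aeO | exact: eaO].
  have uvE := EE_seq1 uO vO.
  have uE : u = \sum_a piA (co a u) *m e_ a.
    rewrite [LHS](Omega1_decomp N_gt0 rhoP uO); apply: eq_bigr => a _.
    by rewrite /piA /frame tensmx_mul mulmx1 mul1mx.
  have vE : v = \sum_b e_ b *m piA (co b v).
    rewrite [LHS](Omega1_decomp N_gt0 rhoP vO); apply: eq_bigr => b _.
    by rewrite frame_mul.
  have := gT _ _ uvE s'E; rewrite {1}/gext big_seq1 /= => ->.
    rewrite /gext /s' big_allpairs_dep; apply: eq_bigr => i _; apply: eq_bigr => j _ /=.
    rewrite (gL _ _ _ (e_in i) (eaO _ j)).1 (gL _ _ _ (e_in i) (e_in j)).2 GE.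
    by rewrite mul_scalar_mx -scalemxAr.
  apply: teqE => // i j; rewrite co2_seq1 co2E /s' big_allpairs_dep.
  rewrite [u in LHS]uE [v in LHS]vE raddf_sum mulmx_suml; apply: eq_bigr => a _.
  by rewrite raddf_sum mulmx_sumr.
exists G; split=> //.
(* A row vector killed by G yields a one-form that pairs to zero with all others, hence vanishes by
   nondegeneracy. *)
- rewrite -row_free_unit -kermx_eq0; apply/rowV0P => v /sub_kermxP vG.
  pose u := \sum_i (v 0 i)%:M *t sig i : BH.
  have uO : Omega1 u by exact: Omega1_sum_sig.
  have O0 : Omega1 0 by exists [::]; rewrite big_nil.
  have u0 : u = 0.
    apply: gI => // x xO; rewrite !gE //.
    rewrite [RHS]big1 => [|i _]; last first.
      by rewrite big1 // => j _; rewrite raddf0 mul0mx scaler0.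
    rewrite exchange_big big1 // => j _ /=.
    transitivity ((v *m G) 0 j *: co j x); last by rewrite vG mxE scale0r.
    rewrite mxE scaler_suml; apply: eq_bigr => i _.
    by rewrite co_sum_sig mul_scalar_mx scalerA mulrC.
  apply/rowP => i; have := co_sum_sig i (fun i => (v 0 i)%:M : AN); rewrite -/u u0.
  by rewrite raddf0 mxE -(raddf0 (@scalar_mx _ _)) => /scalar_mx_inj.
- apply/matrixP => i j; rewrite mxE.
  have ijE := EE_seq1 (e_in i) (e_in j).
  have [sE _] := sigmaP ijE.
  have gextE s : EE s -> gext g0 s = \sum_a \sum_b G a b *: co2 a b s.
    move=> tE; transitivity (\sum_(q <- s) \sum_a \sum_b G a b *: (co a q.1 *m co b q.2)).
      rewrite /gext big_seq [RHS]big_seq; apply: eq_bigr => q /tE[q1 q2]; exact: gE.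
    rewrite exchange_big; apply: eq_bigr => a _; rewrite exchange_big.
    by apply: eq_bigr => b _; rewrite co2E scaler_sumr.
  apply: (@scalar_mx_inj N); rewrite -!GE.
  transitivity (gext g0 (sigma [:: (e_ i, e_ j)])); last by rewrite gS // /gext big_seq1.
  have jiE := EE_seq1 (e_in j) (e_in i).
  transitivity (gext g0 [:: (e_ j, e_ i)]); first by rewrite /gext big_seq1.
  rewrite !gextE //; apply: eq_bigr => a _; apply: eq_bigr => b _.
  by rewrite (co2_sigma N_gt0 rhoP a b sigmaP ijE) !co2_seq1 !co_frame -!scalar_mxM mulrC.
Qed.

(** On central forms g(w (x) e) is a scalar, so d(g(w (x) e)) = 0. Since sigma exchanges the
    coordinates of q.2 (x) e, the first term contracts the first leg of [nab w] with e. *)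
Lemma compatibleP (G : 'M[C]_3) nab : (forall w, Omega1 w -> EE (nab w)) ->
  (forall u v, Omega1 u -> Omega1 v ->
    g0 u v = \sum_i \sum_j G i j *: (co i u *m co j v)) ->
  compatible rho sigma g0 nab <-> forall w e, ZE w -> ZE e -> forall m,
    \sum_i \sum_j G i j *: (co2 i m (nab w) *m co j e)
    + \sum_i \sum_j G i j *: (co i w *m co2 j m (nab e)) = 0.
Proof.
move=> nabE gE.
have contractE u t m : Omega1 u -> EE t ->
    co m (\sum_(r <- t) piA (g0 u r.1) *m r.2)
    = \sum_i \sum_j G i j *: (co i u *m co2 j m t).
  move=> uO tE; rewrite raddf_sum.
  transitivity (\sum_(r <- t) \sum_i \sum_j G i j *: (co i u *m (co j r.1 *m co m r.2))).
    rewrite big_seq [RHS]big_seq; apply: eq_bigr => r /tE[r1 r2] /=.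
    rewrite co_mull gE // mulmx_suml; apply: eq_bigr => i _.
    by rewrite mulmx_suml; apply: eq_bigr => j _; rewrite -scalemxAl mulmxA.
  rewrite exchange_big; apply: eq_bigr => i _; rewrite exchange_big.
  by apply: eq_bigr => j _; rewrite co2E mulmx_sumr scaler_sumr.
have contractO u t : EE t -> Omega1 (\sum_(r <- t) piA (g0 u r.1) *m r.2).
  move=> tE; apply/(Omega1E N_gt0 rhoP); rewrite raddf_sum big_seq big1 // => r /tE[_ r2] /=.
  by rewrite co0_mull (Omega1_co0 r2) mulmx0.
have sE q e : Omega1 q -> Omega1 e -> EE (sigma [:: (q, e)]).
  by move=> qO eO; have [] := sigmaP (EE_seq1 qO eO).
pose lhs w e := \sum_(q <- nab w) \sum_(r <- sigma [:: (q.2, e)]) piA (g0 q.1 r.1) *m r.2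
    + \sum_(q <- nab e) piA (g0 w q.1) *m q.2.
have lhsO w e : Omega1 w -> Omega1 e -> Omega1 (lhs w e).
  move=> wO eO; apply: Omega1D => //; last exact/contractO/nabE.
  apply/(Omega1E N_gt0 rhoP); rewrite raddf_sum big_seq big1 // => q /(nabE _ wO)[q1 q2] /=.
  by apply/(Omega1E N_gt0 rhoP); apply: contractO; apply: sE.
have lhsE w e m : Omega1 w -> Omega1 e -> co m (lhs w e) =
    \sum_i \sum_j G i j *: (co2 i m (nab w) *m co j e)
    + \sum_i \sum_j G i j *: (co i w *m co2 j m (nab e)).
  move=> wO eO; rewrite raddfD; congr (_ + _); last exact/contractE/nabE.
  rewrite raddf_sum.
  transitivity (\sum_(q <- nab w) \sum_i \sum_j
      G i j *: (co i q.1 *m co m q.2 *m co j e)).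
    rewrite big_seq [RHS]big_seq; apply: eq_bigr => q /(nabE _ wO)[q1 q2] /=.
    rewrite contractE //; last exact: sE.
    apply: eq_bigr => i _; apply: eq_bigr => j _.
    by rewrite (co2_sigma N_gt0 rhoP j m sigmaP (EE_seq1 q2 eO)) co2_seq1 mulmxA.
  rewrite exchange_big; apply: eq_bigr => i _; rewrite exchange_big.
  by apply: eq_bigr => j _; rewrite co2E mulmx_suml scaler_sumr.
have dg0 w e : ZE w -> ZE e -> d (piA (g0 w e)) = 0.
  move=> wZ eZ; rewrite gE; [|by case: wZ|by case: eZ].
  rewrite dD_piA big1 // => k _.
  suff -> : X k *m (\sum_i \sum_j G i j *: (co i w *m co j e))
      = (\sum_i \sum_j G i j *: (co i w *m co j e)) *m X k by rewrite subrr tens0mx.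
  rewrite mulmx_sumr mulmx_suml; apply: eq_bigr => i _.
  rewrite mulmx_sumr mulmx_suml; apply: eq_bigr => j _.
  have [c ->] := ZE_scalar i wZ; have [c' ->] := ZE_scalar j eZ.
  by rewrite -scalemxAl -scalemxAr -scalar_mxM scalar_mxC.
split=> [cP w e wZ eZ m|cP w e wZ eZ].
  have [wO _] := wZ; have [eO _] := eZ.
  rewrite -(lhsE w e m wO eO); apply: etrans (congr1 (co m) _) (raddf0 (co m)).
  by apply: etrans (cP _ _ wZ eZ) _; exact: dg0.
have [wO _] := wZ; have [eO _] := eZ.
rewrite dg0 //; change (lhs w e = 0).
apply: (eq_Omega1 N_gt0 rhoP) => [||m]; first exact: lhsO.
  by exists [::]; rewrite big_nil.
by rewrite raddf0 lhsE // cP.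
Qed.

Lemma compatible_frame (G : 'M[C]_3) nab : G^T = G ->
  (forall w, Omega1 w -> EE (nab w)) ->
  (forall u v, Omega1 u -> Omega1 v ->
    g0 u v = \sum_i \sum_j G i j *: (co i u *m co j v)) ->
  compatible rho sigma g0 nab -> forall k l m,
    \sum_i G l i *: co2 i m (nab (e_ k)) = - \sum_j G k j *: co2 j m (nab (e_ l)).
Proof.
move=> G_sym nabE gE /(compatibleP nabE gE) cP k l m.
have G_symE i j : G j i = G i j by rewrite -{1}G_sym mxE.
apply/eqP; rewrite -addr_eq0; apply/eqP.
apply: etrans (cP _ _ (ZE_frame N_gt0 rhoP k) (ZE_frame N_gt0 rhoP l) m).
congr (_ + _).
  apply: eq_bigr => i _; rewrite (bigD1 l) //= co_frame eqxx mulmx1 big1 => [|j /negPf jl].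
    by rewrite addr0 G_symE.
  by rewrite co_frame jl raddf0 mulmx0 scaler0.
rewrite exchange_big; apply: eq_bigr => j _.
rewrite (bigD1 k) //= co_frame eqxx mul1mx big1 ?addr0 // => i /negPf ik.
by rewrite co_frame ik raddf0 mul0mx scaler0.
Qed.

Lemma levi_civita_unique nab1 nab2 w :
  connection rho nab1 -> torsionless rho nab1 -> compatible rho sigma g0 nab1 ->
  connection rho nab2 -> torsionless rho nab2 -> compatible rho sigma g0 nab2 ->
  Omega1 w -> teq rho (nab1 w) (nab2 w).
Proof.
move=> c1 t1 m1 c2 t2 m2 wO; have [G [G_unit G_sym gE]] := metric_matrix.
have [n1E _ _ _] := c1; have [n2E _ _ _] := c2.
have [D DE] : exists D : 'I_3 -> 'I_3 -> 'I_3 -> AN,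
    forall k i j, D k i j = co2 i j (nab1 (e_ k)) - co2 i j (nab2 (e_ k)).
  by exists (fun k i j => co2 i j (nab1 (e_ k)) - co2 i j (nab2 (e_ k))).
have DS k i j : D k i j = D k j i.
  have := (torsionlessP n2E).1 t2 _ (e_in k) i j.
  rewrite -((torsionlessP n1E).1 t1 _ (e_in k) i j) !DE.
  move: (co2 i j (nab1 _)) (co2 j i (nab1 _)) (co2 i j (nab2 _)) (co2 j i (nab2 _)).
  move=> x y x' y' E; have -> : x = x' - y' + y by rewrite E subrK.
  by rewrite addrAC [x' - y']addrC addrK addrC.
have DA k l m : \sum_i G l i *: D k i m = - \sum_i G k i *: D l i m.
  have A1 := compatible_frame G_sym n1E gE m1 k l m.
  have A2 := compatible_frame G_sym n2E gE m2 k l m.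
  have sumD q r : \sum_i G q i *: D r i m = \sum_i G q i *: co2 i m (nab1 (e_ r))
      - \sum_i G q i *: co2 i m (nab2 (e_ r)).
    by rewrite -sumrB; apply: eq_bigr => i _; rewrite DE scalerBr.
  apply: etrans (sumD l k) _; apply: etrans (congr2 (fun a b => a - b) A1 A2) _.
  by rewrite -opprD; congr (- _); exact/esym/sumD.
(* The D k i j are matrices in A_N subject to equations with complex coefficients; at each entry (x,
   y) these are the hypotheses of [koszul_unique]. *)
have D0 k i j : D k i j = 0.
  apply/matrixP => x y; rewrite [RHS]mxE.
  have Dx0 := koszul_unique (D := fun k => \matrix_(i, j) D k i j x y) G_unit G_sym.
  have /matrixP/(_ i j) : \matrix_(i, j) D k i j x y = 0 :> 'M[C]_3; last by rewrite !mxE.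
  apply: Dx0 => {k i j} [k|k l m]; first by apply/matrixP => i j; rewrite !mxE DS.
  have /matrixP/(_ x y) := DA k l m; rewrite summxE [RHS]mxE summxE => E.
  rewrite mxE [in RHS]mxE.
  transitivity (\sum_i (G l i *: D k i m) x y).
    by apply: eq_bigr => i _; rewrite !mxE.
  by rewrite E; congr (- _); apply: eq_bigr => i _; rewrite !mxE.
apply: teqE => [||i j]; [exact: n1E | exact: n2E |].
rewrite (connection_co2 i j c1 wO) (connection_co2 i j c2 wO).
apply: eq_bigr => k _; congr (_ *m _ + _).
by apply/eqP; rewrite -subr_eq0 -DE D0.
Qed.

Lemma levi_civita_exists : exists nab,
  [/\ connection rho nab, torsionless rho nab & compatible rho sigma g0 nab].
Proof.
have [G [G_unit G_sym gE]] := metric_matrix.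
have G_symE i j : G j i = G i j by rewrite -{1}G_sym mxE.
(* On [frame k] the coordinates are scalars, so the commutators in [torsionlessP] vanish and the
   torsion to prescribe is eps_ijk. *)
have [k|Gam [GamT GamA]] := koszul_exists (E := fun k => \matrix_(i, j) eps i j k)
  G_unit G_sym; first by apply/matrixP => i j; rewrite !mxE eps_swap.
(* The Leibniz extension from the frame: [X_j, co i w] is the (i, j) coordinate of frame_i (x) d(co
   i w). *)
have [nab [nabE co2_nab]] : exists nab : BH -> seq (BH * BH),
    (forall w, EE (nab w)) /\ forall w i j,
      co2 i j (nab w) = \sum_k Gam k i j *: co k w + commx (X j) (co i w).
  exists (fun w => of_co2 (fun i j => \sum_k Gam k i j *: co k w + commx (X j) (co i w))).
  by split=> [w|w i j]; [exact: of_co2_EE | rewrite co2_of_co2].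
exists nab; split.
- split=> [w _|w w' _ _|c w _|w a wO]; first exact: nabE.
  + apply: teqE => [||i j]; [exact: nabE | by apply: EE_cat; exact: nabE |].
    rewrite co2_cat !co2_nab addrACA -big_split; congr (_ + _).
      by apply: eq_bigr => k _; rewrite raddfD scalerDr.
    by rewrite raddfD /commx mulmxDr mulmxDl opprD addrACA.
  + apply: teqE => [||i j]; [exact: nabE | exact: (EE_scale N_gt0 rhoP) |].
    rewrite co2_scale !co2_nab scalerDr scaler_sumr; congr (_ + _).
      by apply: eq_bigr => k _; rewrite linearZ /= !scalerA mulrC.
    by rewrite linearZ /= /commx -scalemxAr -scalemxAl scalerBr.
  apply: teqE => [||i j]; first exact: nabE.
    by apply: EE_cat; [exact: (EE_ract N_gt0 rhoP) | apply: EE_seq1 => //; exact: Omega1_d].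
  rewrite co2_cat co2_ract co2_seq1 !co2_nab mulmxDl mulmx_suml -addrA.
  congr (_ + _); first by apply: eq_bigr => k _; rewrite co_mulr scalemxAl.
  by rewrite co_mulr commx_mul co_dD.
- apply/(torsionlessP (fun w _ => nabE w)) => w wO p l; rewrite !co2_nab.
  have -> : \sum_m eps p l m *: co m w
      = \sum_k Gam k p l *: co k w - \sum_k Gam k l p *: co k w.
    rewrite -sumrB; apply: eq_bigr => k _; rewrite -scalerBl.
    by have /matrixP/(_ p l) := GamT k; rewrite !mxE => ->.
  move: (\sum_k _) (\sum_k _) (commx _ _) (commx _ _) => a b x y.
  by apply/matrixP => i j; rewrite !mxE; ring.
apply/(compatibleP (fun w _ => nabE w) gE) => w e wZ eZ m.
(* Scalar coordinates u and v kill the derivative terms, leaving the sum over k, j of u_k v_j ((G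
   Gam_k)_jm + (G Gam_j)_km). *)
have [u uE] := fin_all_exists (fun k => ZE_scalar k wZ).
have [v vE] := fin_all_exists (fun k => ZE_scalar k eZ).
have nabZ s c i : (forall k, co k s = (c k)%:M) ->
    co2 i m (nab s) = (\sum_k Gam k i m * c k)%:M.
  move=> sE; rewrite co2_nab sE /commx scalar_mxC subrr addr0 raddf_sum.
  by apply: eq_bigr => k _; rewrite sE scale_scalar_mx.
transitivity ((\sum_i \sum_j G i j * ((\sum_k Gam k i m * u k) * v j)
   + \sum_i \sum_j G i j * (u i * (\sum_k Gam k j m * v k)))%:M : AN).
  rewrite raddfD /= !raddf_sum; congr (_ + _); apply: eq_bigr => i _;
    rewrite raddf_sum; apply: eq_bigr => j _ /=.
    by rewrite (nabZ _ _ _ uE) vE -scalar_mxM scale_scalar_mx.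
  by rewrite (nabZ _ _ _ vE) uE -scalar_mxM scale_scalar_mx.
have -> : \sum_i \sum_j G i j * ((\sum_k Gam k i m * u k) * v j)
    = \sum_k \sum_j u k * v j * (G *m Gam k) j m.
  rewrite [LHS]exchange_big [RHS]exchange_big; apply: eq_bigr => j _ /=.
  transitivity (\sum_i \sum_k u k * v j * (G j i * Gam k i m)).
    apply: eq_bigr => i _; rewrite mulr_suml mulr_sumr; apply: eq_bigr => k _.
    by rewrite (G_symE i j); ring.
  rewrite exchange_big; apply: eq_bigr => k _.
  by rewrite -mulr_sumr mxE.
have -> : \sum_i \sum_j G i j * (u i * (\sum_k Gam k j m * v k))
    = \sum_k \sum_j u k * v j * (G *m Gam j) k m.
  apply: eq_bigr => k _.
  transitivity (\sum_i \sum_j u k * v j * (G k i * Gam j i m)).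
    apply: eq_bigr => i _; rewrite !mulr_sumr; apply: eq_bigr => j _; by ring.
  rewrite exchange_big; apply: eq_bigr => j _.
  by rewrite -mulr_sumr mxE.
rewrite -big_split big1 ?raddf0 // => k _; rewrite -big_split big1 // => j _ /=.
by rewrite -mulrDr GamA mulr0.
Qed.

End Metric.
End LeviCivita.

Theorem theorem8p5 (N : nat) (hN : (1 <= N)%N)
  (rho : forall n : 'I_N.+1, 'I_3 -> 'M[C]_n.+1)
  (hrho : forall n : 'I_N.+1, su2_irrep (rho n)) :
  mult_iso rho /\
  exists F : seq ('M[C]_(Hdim N) * 'M[C]_(Hdim N)) -> Prop,
    [/\ right_submodule rho F, direct_sum_ker rho F, wedge_F_iso rho F &
      forall sigma, is_sigma rho F sigma ->
        (forall w e, inZE rho w -> inZE rho e ->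
           teq rho (sigma [:: (w, e)]) [:: (e, w)]) /\
        (forall g0, pR_metric rho sigma g0 ->
           (exists nab, [/\ connection rho nab, torsionless rho nab &
                            compatible rho sigma g0 nab]) /\
           (forall nab1 nab2,
              connection rho nab1 -> torsionless rho nab1 -> compatible rho sigma g0 nab1 ->
              connection rho nab2 -> torsionless rho nab2 -> compatible rho sigma g0 nab2 ->
              forall w, inOmega1 rho w -> teq rho (nab1 w) (nab2 w)))].
Proof.
split; first exact: frame_mult_iso.
exists (@antisym N rho); split.
- exact: antisym_submodule.
- exact: antisym_direct.
- exact: antisym_wedge_iso.
move=> sigma sigmaP; split=> [w e wZ eZ|g0 gP]; first exact: (sigma_flip hN hrho sigmaP).
split; first exact: (levi_civita_exists hN hrho sigmaP gP).
move=> nab1 nab2 c1 t1 m1 c2 t2 m2 w wO.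
exact: (levi_civita_unique hN hrho sigmaP gP c1 t1 m1 c2 t2 m2 wO).
Qed.
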